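(* Let $d\ge 1$ be an integer, let $\mu$ be Lebesgue measure on $\mathbb{R}^d$ and $\nu$ the counting measure on $\mathbb{Z}$. (a) Let $0\neq f\in L^1(\mathbb{R}^d)$, with centered frequency function $r_x$. For all $C>1$, $$\lim_{N\to\infty}\frac{\mu(S_{N,f})}{N^d}=0,\qquad\text{where } S_{N,f}:=\left\{x\in\mathbb{R}^d: |x|\le N,\ \frac{r_x}{|x|}\le\frac1C\right\}.$$ (b) Let $X$ be $\mathbb{R}^d$ with Lebesgue measure or $\mathbb{Z}$ with counting measure, let $0\neq f\in L^1(X)$, with uncentered frequency function $\widetilde r_x$, and for $C>2$ put $$\widetilde S_{N,f}:=\left\{x\in X: |x|\le N,\ \frac{\widetilde r_x}{|x|}\le\frac1C\right\}.$$ Then for all $C>2$, $$\lim_{N\to\infty}\frac{\mu(\widetilde S_{N,f})}{N^d}=0\ \text{ if } X=\mathbb{R}^d,\qquad\text{and}\qquad \lim_{N\to\infty}\frac{\nu(\widetilde S_{N,f})}{N}=0\ \text{ if } X=\mathbb{Z}.$$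
   Context: $N$ ranges over the positive integers; ratios by $|x|$ are considered only for $x\ne0$; $B_r(y)$ is the open Euclidean ball, and $\overline{B_r(y)}$ its closure; $\mathbb{N}$ denotes the non-negative integers. Here $f\neq 0$ means $f$ is not the zero element of $L^1$. Centered, continuous: for $f\in L^1(\mathbb{R}^d)$ put $A_r|f|(x)=\frac{1}{\mu(B_r(x))}\int_{B_r(x)}|f(y)|\,dy$ and $Mf(x)=\sup_{r>0}A_r|f|(x)$. Let $E_{f,x}=\{r>0: Mf(x)=A_r|f|(x)\}$; then $r_x=\inf E_{f,x}$ if $E_{f,x}\neq\emptyset$, and $r_x=0$ otherwise. Uncentered, continuous: for $f\in L^1(\mathbb{R}^d)$, $\widetilde Mf(x)=\sup\{A_r|f|(y): r>0,\ y\in\mathbb{R}^d,\ x\in\overline{B_r(y)}\}$. Let $\widetilde E_{f,x}=\{r>0:\text{ there is } y\in\mathbb{R}^d \text{ with } x\in\overline{B_r(y)} \text{ and } \widetilde Mf(x)=A_r|f|(y)\}$; then $\widetilde r_x=\inf\widetilde E_{f,x}$ if $\widetilde E_{f,x}\neq\emptyset$, and $\widetilde r_x=0$ otherwise. Uncentered, discrete: for $f\in\ell^1(\mathbb{Z})=L^1(\mathbb{Z})$ and $\rho,s\in\mathbb{N}$, put $A_{\rho,s}|f|(n)=\frac{1}{\rho+s+1}\sum_{j=-\rho}^{s}|f(n+j)|$ and $\widetilde Mf(n)=\sup_{\rho,s\in\mathbb{N}}A_{\rho,s}|f|(n)$. The supremum is attained, and $\widetilde r_n=\frac12\min\{\rho+s: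 \rho,s\in\mathbb{N},\ \widetilde Mf(n)=A_{\rho,s}|f|(n)\}$. The functions $x\mapsto r_x$ and $x\mapsto\widetilde r_x$ on $\mathbb{R}^d$ are Lebesgue measurable. *)

(* Defs.v *)
From HB Require Import structures.
From mathcomp Require Import all_boot all_order all_algebra.
From mathcomp Require Import all_classical all_reals all_analysis.

Set Implicit Arguments.
Unset Strict Implicit.
Unset Printing Implicit Defensive.

Import Order.TTheory GRing.Theory Num.Theory.
Import numFieldNormedType.Exports.

Local Open Scope classical_set_scope.
Local Open Scope ring_scope.

Section borel_measure.
Context (R : realType).
Local Notation RM := (measurableTypeR R).

Definition tuple_consp n (p : RM * n.-tuple RM) : n.+1.-tuple RM :=
  [the n.+1.-tuple RM of p.1 :: p.2].

Lemma measurable_tuple_consp n : measurable_fun [set: RM * n.-tuple RM] (@tuple_consp n).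
Proof. by apply: measurable_cons; [exact: measurable_fst|exact: measurable_snd]. Qed.

Definition tuple_lebesgueS n
    (m : {sigma_finite_measure set (n.-tuple RM) -> \bar R}) :
    set (n.+1.-tuple RM) -> \bar R :=
  pushforward (@lebesgue_measure R \x m)%E (@tuple_consp n).

Section tuple_lebesgueS.
Context n (m : {sigma_finite_measure set (n.-tuple RM) -> \bar R}).

Let tuple_lebesgueS0 : tuple_lebesgueS m set0 = 0%E.
Proof. by rewrite /tuple_lebesgueS /pushforward preimage_set0 measure0. Qed.

Let tuple_lebesgueS_ge0 A : (0 <= tuple_lebesgueS m A)%E.
Proof. by rewrite /tuple_lebesgueS /pushforward measure_ge0. Qed.

Let tuple_lebesgueS_additive : semi_sigma_additive (tuple_lebesgueS m).
Proof.
apply: (@measure_semi_sigma_additive _ _ _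
  (pushforward (@lebesgue_measure R \x m)%E (@tuple_consp n))).
exact: measurable_tuple_consp.
Qed.

HB.instance Definition _ := isMeasure.Build _ _ _ (tuple_lebesgueS m)
  tuple_lebesgueS0 tuple_lebesgueS_ge0 tuple_lebesgueS_additive.

Let tuple_lebesgueS_sigma_finite : sigma_finite setT (tuple_lebesgueS m).
Proof.
have /sigma_finiteP[F [TF ndF Foo]] := sigma_finiteT (@lebesgue_measure R).
have /sigma_finiteP[G [TG ndG Goo]] := sigma_finiteT m.
pose g (t : n.+1.-tuple RM) : (RM * n.-tuple RM)%type :=
  (thead t, [tuple of behead t]).
have gK : cancel (@tuple_consp n) g.
  by move=> [x t]; congr pair; apply/val_inj.
have mg : measurable_fun setT g.
  apply/measurable_fun_pairP; split; first exact: measurable_tnth.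
  exact: measurable_behead.
exists (fun k => g @^-1` (F k `*` G k)).
  apply/seteqP; split => // t _.
  have [i _ Fi] : (\bigcup_i F i) (g t).1 by rewrite -TF.
  have [j _ Gj] : (\bigcup_i G i) (g t).2 by rewrite -TG.
  exists (maxn i j) => //; split.
    by move: Fi; exact/subsetPset/ndF/leq_maxl.
  by move: Gj; exact/subsetPset/ndG/leq_maxr.
move=> k; have [mF Fk] := Foo k; have [mG Gk] := Goo k; split.
  by rewrite -[X in measurable X]setTI; apply: mg => //; exact: measurableX.
rewrite /tuple_lebesgueS /pushforward (_ : _ @^-1` _ = F k `*` G k); last first.
  by rewrite -comp_preimage (_ : g \o _ = id)//; apply/funext => p; exact: gK.
by rewrite product_measure1E// lte_mul_pinfty// ge0_fin_numE.
Qed.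

HB.instance Definition _ := Measure_isSigmaFinite.Build _ _ _
  (tuple_lebesgueS m) tuple_lebesgueS_sigma_finite.

End tuple_lebesgueS.

(* The [n]-fold product of the one-dimensional Lebesgue measure, on the product
   (Borel) sigma-algebra of [R^n]. *)
Fixpoint tuple_lebesgue n : {sigma_finite_measure set (n.-tuple RM) -> \bar R} :=
  if n is k.+1 then tuple_lebesgueS (tuple_lebesgue k)
  else \d_ ([tuple] : 0.-tuple RM).

End borel_measure.

Section lebesgue.
Context (R : realType) (d : nat).

Definition row_of_tuple (t : d.-tuple (measurableTypeR R)) : 'rV[R]_d :=
  \row_i tnth t i.

Definition lebesgue_outer (A : set 'rV[R]_d) : \bar R :=
  ((tuple_lebesgue R d)^*)%mu (row_of_tuple @^-1` A).

Let lebesgue_outer0 : lebesgue_outer set0 = 0%E.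
Proof. by rewrite /lebesgue_outer preimage_set0 outer_measure0. Qed.

Let lebesgue_outer_ge0 A : (0 <= lebesgue_outer A)%E.
Proof. exact: outer_measure_ge0. Qed.

Let le_lebesgue_outer : {homo lebesgue_outer : A B / A `<=` B >-> (A <= B)%E}.
Proof. by move=> A B AB; apply: le_outer_measure => t /AB. Qed.

Let lebesgue_outer_subadditive : sigma_subadditive lebesgue_outer.
Proof.
move=> F; rewrite /lebesgue_outer preimage_bigcup.
exact: outer_measure_sigma_subadditive.
Qed.

HB.instance Definition _ := isOuterMeasure.Build R _ lebesgue_outer
  lebesgue_outer0 lebesgue_outer_ge0 le_lebesgue_outer
  lebesgue_outer_subadditive.

(* Complete Lebesgue measure: its sigma-algebra (the Caratheodory-measurable
   sets) is the Lebesgue, not merely the Borel, sigma-algebra of [R^d]. *)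
Definition lebesgue : set (caratheodory_type lebesgue_outer) -> \bar R :=
  lebesgue_outer.

Let lebesgue0 : lebesgue set0 = 0%E.
Proof. exact: outer_measure0. Qed.

Let lebesgue_ge0 A : (0 <= lebesgue A)%E.
Proof. exact: outer_measure_ge0. Qed.

Let lebesgue_additive : semi_sigma_additive lebesgue.
Proof.
by move=> F mF tF mUF; exact: caratheodory_measure_sigma_additive.
Qed.

HB.instance Definition _ := isMeasure.Build _ _ _ lebesgue
  lebesgue0 lebesgue_ge0 lebesgue_additive.

End lebesgue.

(* The norm that the library puts on ['rV[R]_d] is the sup norm; it induces the
   same topology, hence the same closures. *)
Definition enorm (R : realType) (d : nat) (x : 'rV[R]_d) : R :=
  Num.sqrt (\sum_(i < d) x ord0 i ^+ 2).

Definition eball (R : realType) (d : nat) (x : 'rV[R]_d) (r : R) : set 'rV[R]_d :=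
  [set y | enorm (y - x) < r].

Section continuous.
Context (R : realType) (d : nat).
Implicit Types (f : 'rV[R]_d -> R) (x y : 'rV[R]_d) (r : R).

Definition avg f x r : \bar R :=
  ((lebesgue (eball x r))^-1 * \int[@lebesgue R d]_(y in eball x r) `|(f y)%:E|)%E.

Definition centered_max f x : \bar R :=
  ereal_sup [set avg f x r | r in [set r | 0 < r]].

Definition centered_radii f x : set R :=
  [set r | 0 < r /\ centered_max f x = avg f x r].

Definition centered_freq f x : R :=
  if centered_radii f x == set0 then 0 else inf (centered_radii f x).

Definition uncentered_max f x : \bar R :=
  ereal_sup [set a | exists r y,
    [/\ 0 < r, closure (eball y r) x & a = avg f y r]].

Definition uncentered_radii f x : set R :=
  [set r | 0 < r /\
    exists2 y, closure (eball y r) x & uncentered_max f x = avg f y r].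

Definition uncentered_freq f x : R :=
  if uncentered_radii f x == set0 then 0 else inf (uncentered_radii f x).

End continuous.

Definition minset_nat (A : set nat) : nat :=
  if pselect (exists k, `[< A k >]) is left exA then ex_minn exA else 0%N.

Section discrete.
Context (R : realType).
Implicit Types (f : int -> R) (n : int).

(* The index [j] of the average over [-rho <= j <= s] is written [i - rho]. *)
Definition zavg f n (rho s : nat) : R :=
  (rho + s + 1)%N%:R^-1 *
  \sum_(0 <= i < (rho + s + 1)%N) `|f (n + (i%:Z - rho%:Z))|.

Definition zuncentered_max f n : \bar R :=
  ereal_sup [set (zavg f n p.1 p.2)%:E | p in [set: nat * nat]].

Definition zuncentered_freq f n : R :=
  2^-1 * (minset_nat [set k | exists rho s : nat,
    k = (rho + s)%N /\ zuncentered_max f n = (zavg f n rho s)%:E])%:R.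

End discrete.

Definition low_freq_set (R : realType) (X : zmodType) (nrm freq : X -> R)
    (C : R) (N : nat) : set X :=
  [set x | [/\ x != 0, nrm x <= N%:R & freq x / nrm x <= 1 / C]].

(* Main.v *)
Require Import Defs.
From mathcomp Require Import all_boot all_order all_algebra.
From mathcomp Require Import finmap.
From mathcomp Require Import all_classical all_reals all_analysis.
From mathcomp Require Import measurable_realfun.
From mathcomp Require Import ring lra zify.

(** Put [kappa = 0] in the centered and [kappa = 1] in the uncentered case, so
    that the balls [B_r(y)] competing at [x] are those with
    [|x - y| <= kappa r], and [C > 1 + kappa].  For [|x| <= N] with [N] large, the
    ball [B_2N(x)] shows that the maximal function at [x] is at least [c / N^d].
    If the frequency at [x] is at most [|x| / C], some competing ball of radius
    less than [|x| / C'], with [1 + kappa < C' < C], has average greater than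
    [c / N^d]; this ball stays at distance at least [(1 - (1 + kappa) / C') |x|]
    from the origin.  Hence, outside [|x| < eps N], the set of low frequency is
    contained in a superlevel set, at height comparable to [N^-d], of the
    uncentered maximal function of the tail [f 1_{|z| >= delta eps N}].  By the
    weak type (1,1) inequality its measure is [O(N^d)] times the mass of that
    tail, which tends to [0].  On [Z] a greedy choice of one-sided intervals
    replaces the Vitali covering. *)

Import Order.TTheory GRing.Theory Num.Theory.
Import numFieldNormedType.Exports.

Local Open Scope classical_set_scope.
Local Open Scope ring_scope.

(** * Euclidean norm and its comparison with the sup norm *)

Section enorm.
Context (R : realType) (d : nat).
Implicit Types (x y z : 'rV[R]_d) (r e : R).

Lemma enorm_ge0 x : 0 <= enorm x.
Proof. exact: sqrtr_ge0. Qed.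

Lemma sqr_enorm x : enorm x ^+ 2 = \sum_(i < d) x ord0 i ^+ 2.
Proof. by rewrite sqr_sqrtr// sumr_ge0// => i _; exact: sqr_ge0. Qed.

Lemma enorm_le x r : 0 <= r ->
  (enorm x <= r) = (\sum_(i < d) x ord0 i ^+ 2 <= r ^+ 2).
Proof. by move=> r0; rewrite -sqr_enorm ler_sqr ?nnegrE ?enorm_ge0. Qed.

Lemma enormZ a x : enorm (a *: x) = `|a| * enorm x.
Proof.
rewrite -sqrtr_sqr -sqrtrM ?sqr_ge0// mulr_sumr; congr Num.sqrt.
by apply: eq_bigr => i _; rewrite mxE exprMn.
Qed.

Lemma enorm0 : enorm (0 : 'rV[R]_d) = 0.
Proof. by rewrite -[X in enorm X](scale0r 0) enormZ normr0 mul0r. Qed.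

Lemma enormN x : enorm (- x) = enorm x.
Proof. by rewrite -scaleN1r enormZ normrN1 mul1r. Qed.

Lemma enormB x y : enorm (x - y) = enorm (y - x).
Proof. by rewrite -opprB enormN. Qed.

Lemma enorm_eq0 x : (enorm x == 0) = (x == 0).
Proof.
apply/idP/eqP => [|->]; last by rewrite enorm0.
move=> /eqP x0; apply/rowP => i; rewrite mxE.
have /eqP : \sum_(i < d) x ord0 i ^+ 2 = 0 by rewrite -sqr_enorm x0 expr0n.
rewrite psumr_eq0 => [/allP/(_ i)|j _]; last exact: sqr_ge0.
by rewrite mem_index_enum sqrf_eq0 => /(_ isT)/eqP.
Qed.

Lemma coord_le_enorm x i : `|x ord0 i| <= enorm x.
Proof.
rewrite -(ler_pXn2r (isT : (0 < 2)%N)) ?nnegrE ?enorm_ge0//.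
rewrite sqr_enorm real_normK ?num_real// (bigD1 i)//= lerDl sumr_ge0// => j _.
exact: sqr_ge0.
Qed.

Lemma enorm_le_coord x e : 0 <= e -> (forall i, `|x ord0 i| <= e) ->
  enorm x <= d%:R * e.
Proof.
move=> e0 xe; rewrite enorm_le ?mulr_ge0//.
apply: (@le_trans _ _ (\sum_(i < d) e ^+ 2)).
  by apply: ler_sum => i _; rewrite -real_normK ?num_real// lerXn2r ?nnegrE.
(* The sum is [d * e ^+ 2], and the crude bound [d <= d ^ 2] gives the constant [d] in place of its
   square root. *)
rewrite sumr_const card_ord exprMn -[leLHS]mulr_natl ler_wpM2r ?sqr_ge0//.
by rewrite -natrX ler_nat expnS expn1; case: d => // n; rewrite leq_pmulr.
Qed.

(** Cauchy-Schwarz: with [s] the inner product, the squares [(enorm y * x_i - enorm x * y_i) ^+ 2]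
    add up to [2 * enorm x * enorm y * (enorm x * enorm y - s)], and the positive factor cancels. *)
Lemma dot_le_enorm x y :
  \sum_(i < d) x ord0 i * y ord0 i <= enorm x * enorm y.
Proof.
have [y0|y0] := eqVneq (enorm y) 0.
  move/eqP: (y0); rewrite enorm_eq0 => /eqP ->.
  by rewrite enorm0 mulr0 big1// => i _; rewrite mxE mulr0.
have yp : 0 < enorm y by rewrite lt_def y0 enorm_ge0.
have [x0|x0] := eqVneq (enorm x) 0.
  move/eqP: (x0); rewrite enorm_eq0 => /eqP ->.
  by rewrite enorm0 mul0r big1// => i _; rewrite mxE mul0r.
have xp : 0 < enorm x by rewrite lt_def x0 enorm_ge0.
set s := \sum_(i < d) _.
have h : 0 <= enorm y ^+ 2 * enorm x ^+ 2 - 2 * enorm x * enorm y * s +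
    enorm x ^+ 2 * enorm y ^+ 2.
  rewrite {1}(sqr_enorm x) {2}(sqr_enorm y) /s !mulr_sumr -sumrB -big_split/=.
  apply: sumr_ge0 => i _; rewrite [leRHS](_ : _ =
    (enorm y * x ord0 i - enorm x * y ord0 i) ^+ 2) ?sqr_ge0//; ring.
have {}h : 0 <= enorm x * enorm y * (enorm x * enorm y - s) by nra.
by rewrite pmulr_rge0 ?mulr_gt0// subr_ge0 in h.
Qed.

Lemma enormD x y : enorm (x + y) <= enorm x + enorm y.
Proof.
rewrite enorm_le ?addr_ge0 ?enorm_ge0//.
under eq_bigr do rewrite mxE sqrrD.
rewrite !big_split/= -!sqr_enorm sqrrD lerD2r lerD2l.
by rewrite mulr2n lerD ?dot_le_enorm.
Qed.

Lemma enorm_trans z x y : enorm (x - y) <= enorm (x - z) + enorm (z - y).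
Proof. by rewrite -[x - y](subrKA z) enormD. Qed.

Lemma ball_rVP x e y :
  ball x e y <-> 0 < e /\ forall i, `|x ord0 i - y ord0 i| < e.
Proof.
split=> [[e0 h]|[e0 h]]; first by split=> // i; have := h ord0 i.
by split=> // i j; rewrite ord1; exact: h.
Qed.

Lemma ball_sub_eball x e : ball x e `<=` [set y | enorm (x - y) <= d%:R * e].
Proof.
move=> y /ball_rVP[e0 h] /=; apply: enorm_le_coord; first exact: ltW.
by move=> i; rewrite !mxE ltW.
Qed.

Lemma eball_sub_ball x e : eball x e `<=` ball x e.
Proof.
move=> y /= xy; apply/ball_rVP; split; first exact: le_lt_trans (enorm_ge0 _) xy.
move=> i; rewrite distrC; apply: le_lt_trans xy.
by have := coord_le_enorm (y - x) i; rewrite !mxE.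
Qed.

End enorm.

(** * Borel sets, boxes and norm-defined sets under Lebesgue measure *)

Section lebesgue_theory.
Context (R : realType).
Local Notation RM := (measurableTypeR R).
Local Notation mu d := (@lebesgue R d).
Local Notation lebesgueT d := (caratheodory_type (@lebesgue_outer R d)).

(** Preimages under [row_of_tuple] commute with intersection and complement, so the Caratheodory
    splitting by a Borel set of tuples carries over to rows. *)
Lemma lebesgue_measurable d (A : set 'rV[R]_d) :
  measurable (@row_of_tuple R d @^-1` A) -> measurable (A : set (lebesgueT d)).
Proof.
move=> mA; apply: le_caratheodory_measurable => X.
by rewrite -(@caratheodory_measurable_mu_ext _ _ _ (tuple_lebesgue R d) _ mA).
Qed.

Lemma lebesgueE d (A : set 'rV[R]_d) :
  measurable (@row_of_tuple R d @^-1` A) ->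
  mu d A = tuple_lebesgue R d (@row_of_tuple R d @^-1` A).
Proof. by move=> mA; exact: measurable_mu_extE. Qed.

Lemma le_lebesgue d (A B : set 'rV[R]_d) : A `<=` B -> (mu d A <= mu d B)%E.
Proof. exact: (@le_outer_measure _ _ (@lebesgue_outer R d)). Qed.

Lemma measurable_tuple_box n (B : 'I_n -> set RM) :
  (forall i, measurable (B i)) ->
  measurable [set t : n.-tuple RM | forall i, B i (tnth t i)].
Proof.
move=> mB.
rewrite (_ : mkset _ = \bigcap_(i in [set: 'I_n]) ((@tnth n RM)^~ i @^-1` B i)).
  apply: fin_bigcap_measurable => // i _.
  rewrite -[X in measurable X]setTI; exact: measurable_tnth.
by apply/seteqP; split=> t /= h i => [_|]; exact: h.
Qed.

Lemma tuple_lebesgue_box n (B : 'I_n -> set RM) : (forall i, measurable (B i)) ->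
  tuple_lebesgue R n [set t | forall i, B i (tnth t i)] =
  (\prod_(i < n) lebesgue_measure (B i))%E.
Proof.
elim: n B => [|n ih] B mB.
  rewrite big_ord0 /= diracE mem_set//=; by case.
rewrite big_ord_recl -ih // /tuple_lebesgue /= -/(tuple_lebesgue R n).
rewrite /tuple_lebesgueS /pushforward -product_measure1E//; last first.
  by apply: (@measurable_tuple_box _ (fun i => B (lift ord0 i))) => i; exact: mB.
congr product_measure1; apply/seteqP; split=> [[a t]/= h|[a t]/= [ha h] i].
  by split=> [|i]; [have := h ord0|have := h (lift ord0 i); rewrite tnthS].
by case: (unliftP ord0 i) => [j|] ->; rewrite ?tnthS.
Qed.

Lemma preimage_ball d (x : 'rV[R]_d) e : 0 < e -> @row_of_tuple R d @^-1` ball x e =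
  [set t | forall i, ball (x ord0 i) e (tnth t i)].
Proof.
move=> e0; apply/seteqP; split=> t /=; last first.
  by move=> h; apply/ball_rVP; split=> // i; have := h i; rewrite mxE.
by move=> /ball_rVP[_ h] i; have := h i; rewrite mxE.
Qed.

Lemma measurable_preimage_ball d (x : 'rV[R]_d) e : 0 < e ->
  measurable (@row_of_tuple R d @^-1` ball x e).
Proof.
move=> e0; rewrite preimage_ball//.
by apply: (@measurable_tuple_box _ (fun i => ball (x ord0 i) e)) => i; exact: measurable_ball.
Qed.

Lemma lebesgue_ball d (x : 'rV[R]_d) e : 0 < e ->
  mu d (ball x e) = ((e *+ 2) ^+ d)%:E.
Proof.
move=> e0; rewrite lebesgueE; last exact: measurable_preimage_ball.
rewrite preimage_ball// (@tuple_lebesgue_box _ (fun i => ball (x ord0 i) e)); last by move=> i; exact: measurable_ball.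
under eq_bigr do rewrite lebesgue_measure_ball ?(ltW e0)//.
by rewrite prodEFin prodr_const card_ord.
Qed.

Lemma measurable_enorm_preimage d (y : 'rV[R]_d) (B : set RM) : measurable B ->
  measurable (@row_of_tuple R d @^-1` [set z | B (enorm (z - y))]).
Proof.
move=> mB.
have mf : measurable_fun setT
    (fun t : d.-tuple RM => enorm (row_of_tuple t - y) : RM).
  apply: measurableT_comp => //; first by apply: continuous_measurable_fun; exact: sqrt_continuous.
  apply: measurable_sum => i; apply: measurable_funX.
  rewrite (_ : (fun _ => _) = (fun t : d.-tuple RM => tnth t i - y ord0 i)).
    by apply: measurable_funB => //; exact: measurable_tnth.
  by apply/funext => t; rewrite !mxE.
by rewrite -[X in measurable X]setTI; exact: mf.
Qed.

Lemma measurable_enorm d (y : 'rV[R]_d) (B : set RM) : measurable B ->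
  measurable ([set z | B (enorm (z - y))] : set (lebesgueT d)).
Proof.
by move=> mB; apply: lebesgue_measurable; exact: measurable_enorm_preimage.
Qed.

End lebesgue_theory.

(** * Spheres are null sets *)

Section balls.
Context (R : realType) (d : nat).
Local Notation RM := (measurableTypeR R).
Local Notation V := 'rV[R]_d.+1.
Local Notation mu := (@lebesgue R d.+1).
Local Notation lebesgueT := (caratheodory_type (@lebesgue_outer R d.+1)).
Implicit Types (y : V) (r : R).

(** Fubini: once all coordinates but the first are fixed, at most two values of the first one remain
    on the sphere, so every section is null. *)
Lemma lebesgue_sphere y r : mu [set z | enorm (z - y) = r] = 0%E.
Proof.
have mS := @measurable_enorm_preimage R d.+1 y [set r] (measurable_set1 r).
rewrite lebesgueE// /=.
rewrite /tuple_lebesgueS /pushforward.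
have mS2 : measurable (tuple_consp (n := d) @^-1`
    (@row_of_tuple R d.+1 @^-1` [set z | [set r] (enorm (z - y))])).
  rewrite -[X in measurable X]setTI.
  exact: (@measurable_tuple_consp R d).
(* The other iterated integral of the product measure has the first coordinate as its inner
   variable. *)
rewrite (@product_measure_unique _ _ _ _ _ _ _
  (lebesgue_measure \x^ tuple_lebesgue R d)%E)//; last first.
  by move=> A B mA mB; exact: product_measure2E.
apply: integral0_eq => t _ /=; apply: countable_lebesgue_measure0.
pose c := r ^+ 2 - \sum_(i < d) (tnth t i - y ord0 (lift ord0 i)) ^+ 2.
apply: (@sub_countable _ _ _ [set y ord0 ord0 + Num.sqrt c; y ord0 ord0 - Num.sqrt c]).
  apply: subset_card_le => a; rewrite /ysection/= inE/= => h.
  have : (a - y ord0 ord0) ^+ 2 = c.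
    rewrite /c -h sqr_enorm big_ord_recl !mxE.
    under eq_bigr do rewrite !mxE tnthS /=.
    by rewrite addrK.
  move/(congr1 Num.sqrt); rewrite sqrtr_sqr => <-.
  by case: (ger0P (a - y ord0 ord0)) => _; [left|right]; rewrite ?opprB /=; ring.
exact: finite_set_countable.
Qed.

End balls.

(** * Limits in the extended reals and continuity of integrals from above *)

Lemma cvge_lt (R : realType) (u : (\bar R)^nat) (l b : \bar R) :
  u k @[k --> \oo] --> l -> (l < b)%E -> \forall k \near \oo, (u k < b)%E.
Proof.
by move=> ul lb; apply: (ul [set y | (y < b)%E]); apply: open_nbhs_nbhs; split=> //;
  exact: open_ereal_lt_ereal.
Qed.

Lemma cvge_gt (R : realType) (u : (\bar R)^nat) (l b : \bar R) :
  u k @[k --> \oo] --> l -> (b < l)%E -> \forall k \near \oo, (b < u k)%E.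
Proof.
by move=> ul lb; apply: (ul [set y | (b < y)%E]); apply: open_nbhs_nbhs; split=> //;
  exact: open_ereal_gt_ereal.
Qed.

(** The total integral is finite, so the integral over a complement is a difference, and monotone
    continuity from below along [F] turns into continuity from above. *)
Lemma cvg_integral_setC d (T : measurableType d) (R : realType)
    (m : {measure set T -> \bar R}) (g : T -> \bar R) (F : (set T)^nat) :
  m.-integrable setT g -> (forall z, 0 <= g z)%E ->
  (forall k, measurable (F k)) -> nondecreasing_seq F ->
  (\int[m]_(z in ~` F k) g z)%E @[k --> \oo] -->
  (\int[m]_(z in ~` (\bigcup_i F i)) g z)%E.
Proof.
move=> ig g0 mF ndF.
have mUF : measurable (\bigcup_i F i) by exact: bigcupT_measurable.
have mg A : measurable A -> measurable_fun A g.
  by move=> mA; apply: measurable_funS (measurable_int _ ig).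
have finI A : measurable A -> (\int[m]_(z in A) g z)%E \is a fin_num.
  by move=> mA; apply: integrable_fin_num => //; exact: integrableS ig.
have splitE A : measurable A -> (\int[m]_(z in ~` A) g z =
    \int[m]_z g z - \int[m]_(z in A) g z)%E.
  move=> mA; rewrite -[in RHS](setUv A) ge0_integral_setU//.
  - by rewrite addeAC subee ?finI// add0e.
  - exact: measurableC.
  - by rewrite setUv; exact: mg.
  - by apply/disj_setPCl.
rewrite splitE//; under eq_fun do rewrite splitE//.
apply: cvgeB; [by rewrite fin_num_adde_defr ?finI|exact: cvg_cst|].
by apply: ge0_nondecreasing_set_cvg_integral => // k; exact: mg.
Qed.


(** * Volume and mass of Euclidean balls *)

Section averages.
Context (R : realType) (d : nat).
Local Notation RM := (measurableTypeR R).
Local Notation V := 'rV[R]_d.+1.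
Local Notation mu := (@lebesgue R d.+1).
Local Notation lebesgueT := (caratheodory_type (@lebesgue_outer R d.+1)).
Implicit Types (x y : V) (r t : R).

Lemma eball_subset x y r s : enorm (x - y) + r <= s -> eball x r `<=` eball y s.
Proof.
move=> h z /= zx; apply: lt_le_trans h.
by apply: (le_lt_trans (@enorm_trans _ _ x _ _)); rewrite addrC ltrD2l.
Qed.

Lemma measurable_eball y r : measurable (eball y r : set lebesgueT).
Proof. exact: (@measurable_enorm R d.+1 y [set s | s < r] (measurable_itv `]-oo, r[)). Qed.

(** In dimension [d.+1] the norm comparison costs a factor [d.+1]; dividing by [d.+2] keeps the
    inequality strict. *)
Lemma ball_subset_eball y r : 0 < r -> ball y (r / d.+2%:R) `<=` eball y r.
Proof.
move=> r0 z /ball_sub_eball /=; rewrite enormB => /le_lt_trans; apply.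
rewrite mulrCA gtr_pMr// ltr_pdivrMr ?ltr0n// mul1r ltr_nat//.
Qed.

Lemma lebesgue_eball_ge y r : 0 < r ->
  (((r / d.+2%:R *+ 2) ^+ d.+1)%:E <= mu (eball y r))%E.
Proof.
move=> r0; rewrite -(@lebesgue_ball _ _ y) ?divr_gt0//.
by apply: le_lebesgue; exact: ball_subset_eball.
Qed.

Lemma lebesgue_eball_le y r : 0 < r -> (mu (eball y r) <= ((r *+ 2) ^+ d.+1)%:E)%E.
Proof.
by move=> r0; rewrite -(@lebesgue_ball _ _ y)//; apply: le_lebesgue; exact: eball_sub_ball.
Qed.

Lemma lebesgue_eball_gt0 y r : 0 < r -> (0 < mu (eball y r))%E.
Proof.
move=> r0; apply: lt_le_trans (lebesgue_eball_ge y r r0).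
by rewrite lte_fin exprn_gt0// pmulrn_lgt0// divr_gt0.
Qed.

Lemma lebesgue_eball_fin y r : 0 < r -> mu (eball y r) \is a fin_num.
Proof.
move=> r0; rewrite ge0_fin_numE ?measure_ge0//.
by apply: le_lt_trans (lebesgue_eball_le y r r0) _; rewrite ltry.
Qed.

Lemma cvg_lebesgue_eball y r :
  mu (eball y (r - k.+1%:R^-1)) @[k --> \oo] --> mu (eball y r).
Proof.
have -> : eball y r = \bigcup_k eball y (r - k.+1%:R^-1).
  apply/seteqP; split=> z; last first.
    by move=> [k _] /=; move/lt_le_trans; apply; rewrite gerBl.
  rewrite /eball/= => zr.
  move: zr; rewrite -subr_gt0 => zr.
  have [N _ /(_ N (leqnn N))/= h] := near_infty_natSinv_lt (PosNum zr).
  by exists N => //=; rewrite ltrBrDl -ltrBrDr.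
apply: nondecreasing_cvg_mu.
- by move=> k; exact: measurable_eball.
- by apply: bigcupT_measurable => k; exact: measurable_eball.
- move=> m n mn; apply/subsetPset => z /= /lt_le_trans; apply.
  by rewrite lerB// lef_pV2 ?posrE// ler_nat ltnS.
Qed.

Section integrable.
Variable f : V -> R.
Hypothesis intf : mu.-integrable setT (EFin \o f).
Local Notation mass A := (\int[mu]_(z in A) `|(f z)%:E|)%E.

Lemma integrable_absf : mu.-integrable setT (fun z => `|(f z)%:E|)%E.
Proof. exact: integrable_abse intf. Qed.

Lemma measurable_absf (A : set lebesgueT) : measurable A ->
  measurable_fun A (fun z : lebesgueT => `|(f z)%:E|)%E.
Proof. by move=> mA; apply: measurable_funS (measurable_int _ integrable_absf). Qed.

Lemma mass_fin (A : set lebesgueT) : measurable A -> mass A \is a fin_num.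
Proof.
by move=> mA; apply: integrable_fin_num => //; exact: integrableS integrable_absf.
Qed.

Lemma mass_ge0 (A : set lebesgueT) : (0 <= mass A)%E.
Proof. by apply: integral_ge0 => z _; exact: abse_ge0. Qed.

Lemma le_mass (A B : set lebesgueT) : measurable A -> measurable B -> A `<=` B ->
  (mass A <= mass B)%E.
Proof. by move=> mA mB; apply: ge0_subset_integral => //; exact: measurable_absf. Qed.

(** The balls of radius [r + k.+1%:R^-1] decrease to the closed ball, whose mass equals that of the
    open ball because the sphere is null. *)
Lemma cvg_mass_eball y r :
  mass (eball y (r + k.+1%:R^-1)) @[k --> \oo] --> mass (eball y r).
Proof.
pose F (k : nat) : set lebesgueT := ~` eball y (r + k.+1%:R^-1).
have mF k : measurable (F k) by apply: measurableC; exact: measurable_eball.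
have FE : \bigcup_k F k = [set z | r < enorm (z - y)].
  apply/seteqP; split=> z /=.
    by move=> [k _ /negP]; rewrite -leNgt; apply: lt_le_trans; rewrite ltrDl.
  rewrite -subr_gt0 => zr.
  have [N _ /(_ N (leqnn N))/= h] := near_infty_natSinv_lt (PosNum zr).
  by exists N => //; apply/negP; rewrite -leNgt addrC -lerBrDr ltW.
have -> : mass (eball y r) = mass (~` \bigcup_k F k).
  rewrite FE (_ : ~` _ = [set z | enorm (z - y) <= r]); last first.
    by apply/seteqP; split=> z /=; rewrite real_ltNge ?num_real ?negbK//;
      [move/negP; rewrite negbK|move=> ->].
  have mC : measurable ([set z | enorm (z - y) <= r] : set lebesgueT).
    exact: (@measurable_enorm R d.+1 y [set s | s <= r] (measurable_itv `]-oo, r])).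
  rewrite [RHS](@ge0_negligible_integral _ _ _ mu _
     ([set z | enorm (z - y) = r] : set lebesgueT))//.
  - congr integral; apply/seteqP; split=> z; rewrite /eball/= lt_neqAle.
      by move=> /andP[/eqP].
    by move=> [-> /eqP ->].
  - exact: (@measurable_enorm R d.+1 y [set r] (measurable_set1 r)).
  - exact: measurable_absf.
  - exact: lebesgue_sphere.
under eq_fun do rewrite -[eball y _]setCK -/(F _).
apply: cvg_integral_setC => //; first exact: integrable_absf.
move=> m n mn; apply/subsetPset; apply: subsetC => z /= /lt_le_trans; apply.
by rewrite lerD2l lef_pV2 ?posrE// ler_nat ltnS.
Qed.

End integrable.
End averages.

(** * Upper semicontinuity of averages in center and radius *)

Section near_maximal_balls.
Context (R : realType) (d : nat).
Local Notation V := 'rV[R]_d.+1.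
Local Notation mu := (@lebesgue R d.+1).
Local Notation lebesgueT := (caratheodory_type (@lebesgue_outer R d.+1)).
Implicit Types (x y : V) (r t : R).
Variable f : V -> R.
Hypothesis intf : mu.-integrable setT (EFin \o f).
Local Notation mass A := (\int[mu]_(z in A) `|(f z)%:E|)%E.

Lemma avgE y r : 0 < r ->
  avg f y r = (fine (mass (eball y r)) / fine (mu (eball y r)))%:E.
Proof.
move=> r0; rewrite /avg mulrC EFinM fineK; last first.
  by apply: mass_fin => //; exact: measurable_eball.
have v0 := lebesgue_eball_gt0 R d y r r0.
have vf := lebesgue_eball_fin R d y r r0.
congr (_ * _)%E; rewrite -[in LHS](fineK vf) inver.
by rewrite gt_eqF// fine_gt0// v0 -ge0_fin_numE ?ltW.
Qed.

Lemma fine_lebesgue_eball_gt0 y r : 0 < r -> 0 < fine (mu (eball y r)).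
Proof.
move=> r0; rewrite fine_gt0// lebesgue_eball_gt0//=.
by rewrite -ge0_fin_numE ?measure_ge0// lebesgue_eball_fin.
Qed.

Lemma lt_avg t y r : 0 < r ->
  (t%:E < avg f y r)%E = (t%:E * mu (eball y r) < mass (eball y r))%E.
Proof.
move=> r0; rewrite avgE// lte_fin ltr_pdivlMr ?fine_lebesgue_eball_gt0//.
rewrite -lte_fin EFinM [X in (_ * X)%E]fineK ?lebesgue_eball_fin// fineK//.
by apply: mass_fin => //; exact: measurable_eball.
Qed.

Lemma avg_lt t y r : 0 < r ->
  (avg f y r < t%:E)%E = (mass (eball y r) < t%:E * mu (eball y r))%E.
Proof.
move=> r0; rewrite avgE// lte_fin ltr_pdivrMr ?fine_lebesgue_eball_gt0//.
rewrite -lte_fin EFinM [X in (_ * X)%E]fineK ?lebesgue_eball_fin// fineK//.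
by apply: mass_fin => //; exact: measurable_eball.
Qed.

Lemma avg_ge0 y r : (0 <= avg f y r)%E.
Proof. by rewrite mule_ge0 ?inve_ge0 ?measure_ge0// mass_ge0. Qed.

(** A nearby ball lies between [eball y (r - q)] and [eball y (r + q)]. Mass is continuous under
    shrinking from outside and volume under growth from inside, so for small [q] a number [b] still
    separates the outer mass from [t] times the inner volume. *)
Lemma avg_usc t y r : 0 < r -> (avg f y r < t%:E)%E ->
  exists2 e, 0 < e & forall y' r',
    enorm (y - y') + `|r - r'| <= e -> 0 < r' /\ (avg f y' r' < t%:E)%E.
Proof.
move=> r0 At.
have t0 : 0 < t by rewrite -lte_fin; exact: le_lt_trans (avg_ge0 y r) At.
move: At; rewrite avg_lt// => At.
have [b /andP[Ib bV]] : exists b : R, (mass (eball y r) < b%:E < t%:E * mu (eball y r))%E.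
  have vf := lebesgue_eball_fin R d y r r0.
  have mf := mass_fin R d f intf _ (measurable_eball R d y r).
  move: At; rewrite -(fineK vf) -(fineK mf) -EFinM lte_fin => At.
  exists ((fine (mass (eball y r)) + t * fine (mu (eball y r))) / 2).
  by rewrite !lte_fin !midf_lt.
have [q [q0 kr Ik Vk]] : exists q : R, [/\ 0 < q, q < r,
    (mass (eball y (r + q)) < b%:E)%E & (b%:E < t%:E * mu (eball y (r - q)))%E].
  have h1 := @near_infty_natSinv_lt R (PosNum r0).
  have h2 := cvge_lt _ _ _ _ (cvg_mass_eball R d f intf y r) Ib.
  have h3 := cvge_gt _ _ _ _ (cvgeZl (erefl : t%:E \is a fin_num) (cvg_lebesgue_eball R d y r)) bV.
  by near \oo => k; exists k.+1%:R^-1; split; [rewrite invr_gt0|near: k..].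
exists q => // y' r' h.
have r'0 : 0 < r'.
  have := ler_norm (r - r'); have := enorm_ge0 _ _ (y - y') => ? ?. lra.
split=> //; rewrite avg_lt//.
apply: (@le_lt_trans _ _ (mass (eball y (r + q)))).
  apply: le_mass => //; [exact: measurable_eball|exact: measurable_eball|].
  apply: eball_subset; rewrite enormB.
  have := ler_norm (r' - r); rewrite distrC => ?; lra.
apply: (lt_trans Ik); apply: (lt_le_trans Vk).
rewrite lee_pmul2l// ?lte_fin//; apply: le_lebesgue; apply: eball_subset.
have := ler_norm (r - r') => ?; lra.
Unshelve. all: by end_near.
Qed.

End near_maximal_balls.

(** * From small frequency to a small ball with large average *)

Section attaining_small_radius.
Context (R : realType) (d : nat).
Local Notation V := 'rV[R]_d.+1.
Local Notation mu := (@lebesgue R d.+1).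
Local Notation lebesgueT := (caratheodory_type (@lebesgue_outer R d.+1)).
Implicit Types (x y : V) (r t : R).
Variable f : V -> R.
Hypothesis intf : mu.-integrable setT (EFin \o f).
Local Notation mass A := (\int[mu]_(z in A) `|(f z)%:E|)%E.

Lemma avg_le y r : 0 < r ->
  (avg f y r <= (fine (mass setT) / (r / d.+2%:R *+ 2) ^+ d.+1)%:E)%E.
Proof.
move=> r0; have c0 : 0 < (r / d.+2%:R *+ 2) ^+ d.+1.
  by rewrite exprn_gt0// pmulrn_lgt0// divr_gt0.
have mE := measurable_eball R d y r.
rewrite avgE// lee_fin ler_pM//.
- by rewrite fine_ge0// mass_ge0.
- by rewrite invr_ge0 ltW// fine_lebesgue_eball_gt0.
- by apply: fine_le; rewrite ?mass_fin//; apply: le_mass.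
- rewrite lef_pV2 ?posrE ?fine_lebesgue_eball_gt0// -lee_fin fineK.
    exact: lebesgue_eball_ge.
  exact: lebesgue_eball_fin.
Qed.

Lemma avg_small_radius t : 0 < t -> exists2 rmax : R, 0 < rmax &
  forall y r, 0 < r -> (t%:E < avg f y r)%E -> r <= rmax.
Proof.
move=> t0; pose M := fine (mass setT).
have M0 : 0 <= M by rewrite fine_ge0// mass_ge0.
have Mt0 : 0 <= M / t by rewrite divr_ge0// ltW.
(* Beyond this radius the base [r / d.+2%:R *+ 2] is at least [1 + M / t], hence at least [1], so
   its power exceeds [M / t] and [avg_le] puts the average below [t]. *)
exists (d.+2%:R * (1 + M / t)); first by rewrite mulr_gt0// ltr_wpDr.
move=> y r r0 /lt_le_trans/(_ (avg_le y r r0)); rewrite lte_fin -/M => tM.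
rewrite leNgt; apply/negP => rb.
have h : 1 + M / t <= r / d.+2%:R *+ 2.
  apply: (@le_trans _ _ (r / d.+2%:R)).
    by rewrite ler_pdivlMr// mulrC ltW.
  by rewrite mulr2n lerDr divr_ge0// ltW.
have c0 : 0 < (r / d.+2%:R *+ 2) ^+ d.+1.
  by rewrite exprn_gt0// pmulrn_lgt0// divr_gt0.
move: tM; rewrite ltr_pdivlMr// mulrC -ltr_pdivlMr// => /lt_le_trans.
move/(_ (1 + M / t)); rewrite ltNge lerDr ler01 => /(_ isT)/negP; apply.
apply: (le_trans h).
by rewrite -[leLHS]expr1 ler_weXn2l//; apply: le_trans h; rewrite lerDl.
Qed.

(* If the supremum is not attained, then by upper semicontinuity and compactness
   it is not approached by the averages over the radii in any [[a, rmax]]. *)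
Lemma exists_small_ball (kappa : R) x (m : \bar R) (E : set R) (t a : R) :
  0 <= kappa ->
  m = ereal_sup [set s | exists r y,
    [/\ 0 < r, enorm (x - y) <= kappa * r & s = avg f y r]] ->
  E = [set r | 0 < r /\ exists2 y, enorm (x - y) <= kappa * r & m = avg f y r] ->
  0 < t -> (t%:E < m)%E -> 0 < a ->
  (if E == set0 then 0 else inf E) < a ->
  exists y r, [/\ 0 < r, r < a, enorm (x - y) <= kappa * r & (t%:E < avg f y r)%E].
Proof.
move=> kappa0 mE EE t0 tm a0.
(* If [E] is nonempty, an attaining radius below [a] comes straight from the infimum. The value [0]
   for empty [E] carries no such radius; there the absence of small balls is refuted. *)
case: ifPn => [/eqP E0 _|/set0P Ene Ea]; last first.
  have [r Er ra] : exists2 r, E r & r < a by apply: inf_lt => //; exact: Ene.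
  move: Er; rewrite EE => -[r0 [y xy myr]].
  by exists y, r; split=> //; rewrite -myr.
apply: contrapT => nosmall.
have large y r : 0 < r -> enorm (x - y) <= kappa * r -> (t%:E < avg f y r)%E -> a <= r.
  move=> r0 xy ty; rewrite leNgt; apply/negP => ra.
  by apply: nosmall; exists y, r.
have lem y r : 0 < r -> enorm (x - y) <= kappa * r -> (avg f y r <= m)%E.
  by move=> r0 xy; rewrite mE; apply: ereal_sup_ubound; exists r, y.
have [rmax rmax0 hrmax] := avg_small_radius t t0.
(* Averages above [t] use radii at least [a], where [avg_le] bounds them uniformly. *)
have mfin : (m < +oo)%E.
  apply: (@le_lt_trans _ _
     (Num.max t (fine (mass setT) / (a / d.+2%:R *+ 2) ^+ d.+1))%:E); last exact: ltry.
  rewrite mE; apply: ge_ereal_sup => _ [r [y [r0 xy ->]]].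
  have [ty|ty] := leP (avg f y r) t%:E.
    by apply: (le_trans ty); rewrite lee_fin le_max lexx.
  apply: (le_trans (avg_le y r r0)); rewrite lee_fin le_max; apply/orP; right.
  have ar := large y r r0 xy ty.
  have ap : 0 < (a / d.+2%:R *+ 2) by rewrite pmulrn_lgt0// divr_gt0.
  have arp : a / d.+2%:R *+ 2 <= r / d.+2%:R *+ 2.
    by rewrite lerMn2r ler_pM2r ?invr_gt0.
  have rp := lt_le_trans ap arp.
  rewrite ler_wpM2l ?fine_ge0 ?mass_ge0// lef_pV2 ?posrE ?exprn_gt0//.
  by rewrite lerXn2r// nnegrE ltW.
have mreal : m = (fine m)%:E.
  by rewrite fineK// fin_numE -!ltey -!ltNye mfin andbT (lt_trans _ tm)// ltNyr.
set m' := fine m in mreal.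
have tm' : t < m' by move: tm; rewrite mreal lte_fin.
(* Every admissible pair with average above [t] lies in this compact set: its radius is in
   [[a, rmax]] and its center within [kappa * rmax] of [x] in each coordinate. *)
pose K : set (V * R) :=
  [set v : V | forall i, `[x ord0 i - kappa * rmax, x ord0 i + kappa * rmax]%classic (v ord0 i)]
  `*` `[a, rmax]%classic.
have cK : compact K.
  apply: compact_setX; last exact: segment_compact.
  apply: (@rV_compact _ _ (fun i =>
    `[x ord0 i - kappa * rmax, x ord0 i + kappa * rmax]%classic)) => i.
  exact: segment_compact.
pose P (k : nat) (p : V * R) :=
  0 < p.2 -> enorm (x - p.1) <= kappa * p.2 -> (avg f p.1 p.2 <= (m' - k.+1%:R^-1)%:E)%E.
(* The near-covering form of compactness makes the local gap below [m'] uniform. Inadmissible pairs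
   satisfy [P] vacuously. *)
have : \forall k \near \oo, K `<=` P k.
  apply: (proj1 (compact_near_coveringP K) cK) => -[y r] [/= _].
  rewrite in_itv/= => /andP[ar _].
  have r0 : 0 < r by exact: lt_le_trans ar.
  have [xy|xy] := leP (enorm (x - y)) (kappa * r); last first.
    (* Moving the pair by [e] changes the distance by at most [d.+1%:R * e] and [kappa * r] by at
       most [kappa * e]; the extra [1] keeps nearby pairs inadmissible. *)
    pose e := (enorm (x - y) - kappa * r) / (d.+1%:R + kappa + 1).
    have c0 : 0 < d.+1%:R + kappa + 1 by rewrite ltr_wpDl// addr_ge0.
    have e0 : 0 < e by rewrite divr_gt0// subr_gt0.
    exists (ball (y, r) e, setT); first by split; [exact: nbhsx_ballx|exact: filterT].
    move=> [[y' r'] k] [[/= hy hr] _] _ /= xy'; exfalso.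
    have := ball_sub_eball _ _ _ _ _ hy => /= yy'.
    have := enorm_trans _ _ y' x y; rewrite (enormB _ _ y' y) => h.
    have : `|r - r'| < e by exact: hr.
    rewrite ltr_norml => /andP[h1 h2].
    have eE : e * (d.+1%:R + kappa + 1) = enorm (x - y) - kappa * r.
      by rewrite divfK// gt_eqF.
    nra.
  have Am : (avg f y r < m)%E.
    rewrite lt_neqAle lem// andbT; apply/eqP => Am.
    have : E r by rewrite EE; split=> //; exists y.
    by rewrite E0.
  rewrite mreal in Am.
  have [b /andP[Ab bm]] : exists b : R, (avg f y r < b%:E < m'%:E)%E.
    move: Am; rewrite avgE// lte_fin => Am.
    by eexists; rewrite !lte_fin; apply/andP; split; [exact: (midf_lt Am).1|exact: (midf_lt Am).2].
  have [e e0 he] := avg_usc _ _ _ intf _ _ _ r0 Ab.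
  rewrite lte_fin -subr_gt0 in bm.
  have hk := @near_infty_natSinv_lt R (PosNum bm).
  (* Of the [d.+2] shares of [e], the center uses [d.+1] and the radius one. *)
  have d2 : 0 < e / d.+2%:R by rewrite divr_gt0.
  exists (ball (y, r) (e / d.+2%:R), [set k | k.+1%:R^-1 < m' - b]).
    by split; [exact: nbhsx_ballx|exact: hk].
  move=> [[y' r'] k] [[/= hy hr] hkk] r'0 /= xy'.
  have := ball_sub_eball _ _ _ _ _ hy => /= yy'.
  have rr' : `|r - r'| < e / d.+2%:R by exact: hr.
  have [|_ /ltW/le_trans] := he y' r'.
    rewrite -[e in leRHS](@divfK _ d.+2%:R)// -natr1 mulrDr mulr1 mulrC natr1.
    by rewrite lerD// ltW.
  by apply; rewrite lee_fin lerBrDr -lerBrDl ltW.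
move=> [k _ /(_ k (leqnn k)) KP].
suff : (m <= (Num.max t (m' - k.+1%:R^-1))%:E)%E.
  rewrite mreal lee_fin leNgt => /negP; apply; rewrite gt_max tm' /= gtrBl.
  by rewrite invr_gt0.
rewrite {1}mE; apply: ge_ereal_sup => _ [r [y [r0 xy ->]]].
have [ty|ty] := leP (avg f y r) t%:E.
  by apply: (le_trans ty); rewrite lee_fin le_max lexx.
have rr := hrmax _ _ r0 ty.
apply: (@le_trans _ _ (m' - k.+1%:R^-1)%:E); last by rewrite lee_fin le_max lexx orbT.
apply: (KP (y, r)) => //; split; last first.
  by rewrite /= in_itv/= (large y r) .
move=> i /=; rewrite in_itv/= -ler_distlC.
have := coord_le_enorm _ _ (x - y) i; rewrite !mxE distrC => /le_trans; apply.
by rewrite (le_trans xy)// ler_wpM2l.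
Qed.

End attaining_small_radius.

(** * Vitali covering and the weak type (1,1) inequality *)

Lemma exists_vitali_subfamily (R : realType) (I T : Type) (B : I -> set T)
    (rad : I -> R) (W : set I) (rmax : R) :
  (forall i, W i -> B i !=set0) -> (forall i, W i -> 0 < rad i <= rmax) ->
  exists D, [/\ D `<=` W, trivIset D B & forall i, W i ->
    exists j, [/\ D j, B i `&` B j !=set0 & rad i <= 2 * rad j]].
Proof.
move=> B0 radP.
(* Zorn's lemma is applied to disjoint families in which an index meeting some member also meets a
   member of at least half its radius. If a maximal [D] missed some index, that index would meet no
   member, and an index with more than half the supremal radius among all such could be adjoined. *)
pose P (D : set I) := [/\ D `<=` W, trivIset D B & forall i j, W i -> D j ->
  B i `&` B j !=set0 -> exists j', [/\ D j', B i `&` B j' !=set0 & rad i <= 2 * rad j']].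
have [|D [[DW tD hD] maxD]] := @Zorn_bigcup _ P.
  move=> F FP totF; split.
  - by move=> i [X /FP[XW _ _] /XW].
  - move=> i j [X FX Xi] [Y FY Yj].
    by case: (totF X Y FX FY) => [/(_ i Xi)|/(_ j Yj)] ?;
      [have [_ h _] := FP Y FY|have [_ h _] := FP X FX]; exact: h.
  - move=> i j Wi [X FX Xj] ij; have [_ _ h] := FP X FX.
    have [j' [Xj' ij' rr]] := h i j Wi Xj ij.
    by exists j'; split=> //; exists X.
exists D; split=> // i Wi; apply: contrapT => ni.
pose G := [set i | W i /\ forall j, D j -> ~ (B i `&` B j !=set0)].
have Gi : G i.
  by split=> // j Dj ij; apply: ni; exact: (hD i j).
have supG : has_sup (rad @` G).
  split; first by exists (rad i), i.
  by exists rmax => _ [j [Wj _] <-]; have /andP[] := radP j Wj.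
have s0 : 0 < sup (rad @` G).
  have /andP[ri _] := radP i Wi; apply: (lt_le_trans ri).
  by apply: ub_le_sup; [exact: supG.2|exists i].
have [_ [i0 [Wi0 Gi0] <-]] := sup_adherent (divr_gt0 s0 (ltr0Sn _ 1)) supG.
set s := sup _ in s0 *; rewrite (_ : s - s / 2 = s / 2); last by field.
move=> si0.
apply: (maxD (D `|` [set i0])).
  split; first by move=> j; left.
  move=> /(_ i0 (or_intror erefl)) Di0; apply: (Gi0 i0 Di0).
  by rewrite setIid; exact: B0.
split.
- by move=> j [Dj|->//]; exact: DW.
- move=> j k [Dj|->] [Dk|->] jk //; first exact: tD.
  + by exfalso; apply: (Gi0 j Dj); rewrite setIC.
  + by exfalso; exact: (Gi0 k Dk).
- move=> j k Wj Dk jk.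
  have [[k' Dk' jk']|nj] := pselect (exists2 k', D k' & B j `&` B k' !=set0).
    by have [j' [Dj' jj' rr]] := hD j k' Wj Dk' jk'; exists j'; split=> //; left.
  case: Dk jk => [Dk|->] jk; first by exfalso; apply: nj; exists k.
  exists i0; split=> //; first by right.
  have : rad j <= s.
    apply: ub_le_sup; first exact: supG.2.
    by exists j => //; split=> // k' Dk' jk'; apply: nj; exists k'.
  lra.
Qed.


Section weak_type.
Context (R : realType) (d : nat).
Local Notation V := 'rV[R]_d.+1.
Local Notation mu := (@lebesgue R d.+1).
Local Notation lebesgueT := (caratheodory_type (@lebesgue_outer R d.+1)).
Implicit Types (x y : V) (r t : R).
Variable f : V -> R.
Hypothesis intf : mu.-integrable setT (EFin \o f).
Local Notation mass A := (\int[mu]_(z in A) `|(f z)%:E|)%E.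

Lemma sum_lebesgue_disjoint (A : set lebesgueT) (t : R) (s : seq (V * R)) :
  measurable A -> 0 < t -> uniq s ->
  (forall i, i \in s -> eball i.1 i.2 `<=` A /\
     (t%:E * mu (eball i.1 i.2) <= mass (eball i.1 i.2))%E) ->
  trivIset [set` s] (fun i : V * R => eball i.1 i.2) ->
  (t%:E * \sum_(i <- s) mu (eball i.1 i.2) <= mass A)%E.
Proof.
move=> mA t0 us hs ts.
have mE (i : V * R) : measurable (eball i.1 i.2 : set lebesgueT).
  exact: measurable_eball.
have sA : \big[setU/set0]_(i <- s) eball i.1 i.2 `<=` A.
  by rewrite -bigcup_seq => z [i /= /hs[+ _]]; exact.
have mU : measurable (\big[setU/set0]_(i <- s) eball i.1 i.2 : set lebesgueT).
  by apply: bigsetU_measurable => i _; exact: mE.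
apply: (@le_trans _ _ (mass (\big[setU/set0]_(i <- s) eball i.1 i.2))); last first.
  exact: le_mass.
have -> := @ge0_integral_bigsetU _ lebesgueT R mu _ (fun i : V * R => eball i.1 i.2)
  (fun z => `|(f z)%:E|%E) s mE us ts (measurable_absf _ _ _ intf _ mU)
  (fun z _ => abse_ge0 _).
rewrite ge0_sume_distrr; last by move=> i _; exact: measure_ge0.
rewrite big_seq [leRHS]big_seq; apply: lee_sum => i /hs[_]; exact.
Qed.

Lemma lebesgue_bigsetU_le (I : Type) (s : seq I) (F : I -> set V) :
  (mu (\big[setU/set0]_(i <- s) F i) <= \sum_(i <- s) mu (F i))%E.
Proof.
elim: s => [|i s ih]; first by rewrite !big_nil measure0.
rewrite !big_cons.
apply: (le_trans (outer_measureU2 (@lebesgue_outer R d.+1) _ _)).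
exact: leeD2l.
Qed.

(** The factor [6] is the Vitali dilation, and [d.+2%:R] comes from comparing a ball with the cube
    around it and the cube inside it. *)
Definition weak_const : R := (6 * d.+2%:R) ^+ d.+1.

Lemma lebesgue_dilate y r : 0 < r ->
  (mu (eball y (6 * r)) <= weak_const%:E * mu (eball y r))%E.
Proof.
move=> r0; have r6 : 0 < 6 * r by rewrite mulr_gt0.
apply: (le_trans (lebesgue_eball_le _ _ y _ r6)).
have c0 : (0 <= weak_const%:E)%E by rewrite lee_fin exprn_ge0// mulr_ge0.
apply: le_trans (lee_wpmul2l c0 (lebesgue_eball_ge R d y r r0)).
rewrite -EFinM lee_fin /weak_const -exprMn.
have -> : 6 * d.+2%:R * (r / d.+2%:R *+ 2) = 6 * r *+ 2 :> R; last by [].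
by rewrite mulrnAr -mulrA [d.+2%:R * _]mulrC divfK// pnatr_eq0.
Qed.

Lemma weak_type_bound (A : set lebesgueT) (t : R) (S : set V) :
  measurable A -> 0 < t ->
  (forall x, S x -> exists y r, [/\ 0 < r, enorm (x - y) <= r,
     eball y r `<=` A & (t%:E < avg f y r)%E]) ->
  (mu S <= (weak_const / t * fine (mass A))%:E)%E.
Proof.
move=> mA t0 hS.
have [rmax rmax0 hrmax] := avg_small_radius _ _ _ intf t t0.
pose W := [set i : V * R | [/\ 0 < i.2, eball i.1 i.2 `<=` A &
  (t%:E < avg f i.1 i.2)%E]].
have [||D [DW tD hD]] := @exists_vitali_subfamily R (V * R)%type V
    (fun i => eball i.1 i.2) snd W rmax.
- by move=> [y r] [/= r0 _ _]; exists y; rewrite /eball/= subrr enorm0.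
- by move=> [y r] [/= r0 _ /(hrmax _ _ r0) ->]; rewrite r0.
have Dsum (s : seq (V * R)) : uniq s -> [set` s] `<=` D ->
    (\sum_(i <- s) mu (eball i.1 i.2) <= (fine (mass A) / t)%:E)%E.
  move=> us sD.
  have := @sum_lebesgue_disjoint A t s mA t0 us.
  rewrite -[mass A in X in X -> _]fineK ?mass_fin// muleC -lee_pdivlMr//.
  move=> h; rewrite EFinM; apply: h; last exact: sub_trivIset tD.
  move=> i /sD/DW[i0 iA]; rewrite lt_avg// => /ltW ?.
  by split.
(* Members of radius above [n.+1%:R^-1] have volume bounded below, while [Dsum] bounds the total
   volume; hence each [Dn n] is finite, and the selected family is exhausted by finite pieces. *)
pose Dn (n : nat) := D `&` [set i | n.+1%:R^-1 < i.2].
have finDn n : finite_set (Dn n).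
  apply: contrapT => infDn.
  pose c : R := (n.+1%:R^-1 / d.+2%:R *+ 2) ^+ d.+1.
  have c0 : 0 < c by rewrite exprn_gt0// pmulrn_lgt0// divr_gt0.
  have [N hN] : exists N, fine (mass A) / t / c < N%:R.
    exists (Num.bound `|fine (mass A) / t / c|).
    exact: (le_lt_trans (ler_norm _) (archi_boundP (normr_ge0 _))).
  have [X XD XN] := infinite_set_fset N infDn.
  have := Dsum X (fset_uniq X) (fun i Xi => (XD i Xi).1).
  apply/negP; rewrite -ltNge.
  apply: (@lt_le_trans _ _ (\sum_(i <- X) c%:E)%E).
    rewrite sumEFin lte_fin big_const_seq count_predT iter_addr_0 -mulr_natl.
    by rewrite -ltr_pdivrMr// (lt_le_trans hN)// ler_nat.
  rewrite big_seq [leRHS]big_seq; apply: lee_sum => i /XD[_ /= ni].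
  have i0 : 0 < i.2 by apply: le_lt_trans ni; rewrite invr_ge0.
  apply: le_trans (lebesgue_eball_ge R d i.1 i.2 i0).
  rewrite lee_fin lerXn2r ?nnegrE ?mulrn_wge0 ?divr_ge0 ?(ltW i0)//.
  by rewrite lerMn2r ler_pM2r ?invr_gt0// ltW.
pose E n := \bigcup_(i in Dn n) (eball i.1 (6 * i.2) : set lebesgueT).
have mE n : measurable (E n).
  by apply: fin_bigcup_measurable => // i _; exact: measurable_eball.
have SE : S `<=` \bigcup_n E n.
  move=> x /hS[y [r [r0 xy yA ty]]].
  have [[y' r'] [D' [z [/= zy zy']] rr']] := hD (y, r) (And3 r0 yA ty).
  have [/= r'0 _ _] := DW _ D'.
  have [N _ /(_ N (leqnn N))/= h] := near_infty_natSinv_lt (PosNum r'0).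
  exists N => //; exists (y', r') => //=.
  (* Here [enorm (x - y')] is less than [r + r + r'], which is at most [5 * r']. *)
  have := enorm_trans _ _ y x y'; have := enorm_trans _ _ z y y'.
  rewrite (enormB _ _ y z); move: zy zy' rr' xy; rewrite /eball /= => *.
  lra.
apply: (le_trans (le_lebesgue _ _ _ _ SE)).
have cvgE : mu (E n) @[n --> \oo] --> mu (\bigcup_n E n).
  apply: nondecreasing_cvg_mu => //; first exact: bigcupT_measurable.
  move=> m n mn; apply/subsetPset; apply: bigcup_subset => i [Di /= mi]; split=> //=.
  by apply: le_lt_trans mi; rewrite lef_pV2 ?posrE// ler_nat ltnS.
apply: (cvge_le _ cvgE); apply: nearW => n /=.
have [X XE] := finite_fsetP.1 (finDn n).
rewrite /E XE bigcup_seq; apply: (le_trans (lebesgue_bigsetU_le _ _ _)).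
apply: (@le_trans _ _ (weak_const%:E * \sum_(i <- X) mu (eball i.1 i.2))%E).
  rewrite ge0_sume_distrr; last by move=> i _; exact: measure_ge0.
  rewrite big_seq [leRHS]big_seq; apply: lee_sum => i iX.
  have [/DW[i0 _ _] _] : Dn n i by rewrite XE.
  exact: lebesgue_dilate.
rewrite -mulrA (mulrC t^-1) EFinM; apply: lee_wpmul2l.
  by rewrite lee_fin exprn_ge0// mulr_ge0.
by apply: Dsum => [|i iX]; [exact: fset_uniq|have [] : Dn n i by rewrite XE].
Qed.

End weak_type.

Lemma cvge0_nearP (R : realType) (u : (\bar R)^nat) :
  (forall n, (0 <= u n)%E) ->
  (forall e : R, 0 < e -> \forall n \near \oo, (u n <= e%:E)%E) ->
  u n @[n --> \oo] --> 0%E.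
Proof.
move=> u0 ue.
have ufin : \forall n \near \oo, u n \is a fin_num.
  apply: filterS (ue 1 ltr01) => n un.
  by rewrite ge0_fin_numE//; apply: le_lt_trans un _; exact: ltry.
apply/fine_cvgP; split=> //; apply/cvgrPdist_le => e e0.
near=> n; rewrite sub0r normrN ger0_norm ?fine_ge0//.
rewrite -lee_fin fineK; last by near: n.
by near: n; exact: ue.
Unshelve. all: by end_near.
Qed.

(** * Density of the low-frequency set in Euclidean space *)

Section low_frequency.
Context (R : realType) (d : nat).
Local Notation V := 'rV[R]_d.+1.
Local Notation mu := (@lebesgue R d.+1).
Local Notation lebesgueT := (caratheodory_type (@lebesgue_outer R d.+1)).
Implicit Types (x y : V) (r t : R).
Variable f : V -> R.
Hypothesis intf : mu.-integrable setT (EFin \o f).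
Hypothesis f_neq0 : ~ {ae mu, forall x, f x = 0}.
Local Notation mass A := (\int[mu]_(z in A) `|(f z)%:E|)%E.

Lemma cvg_mass_tail : mass (~` eball (0 : V) k%:R) @[k --> \oo] --> 0%E.
Proof.
rewrite (_ : 0%E = mass (~` \bigcup_k eball (0 : V) k%:R)).
  apply: cvg_integral_setC.
  - exact: integrable_absf.
  - by move=> z; exact: abse_ge0.
  - by move=> k; exact: measurable_eball.
  - move=> m n mn; apply/subsetPset => z /= /lt_le_trans; apply.
    by rewrite ler_nat.
rewrite (_ : \bigcup_k _ = setT) ?setCT ?integral_set0//.
apply/seteqP; split=> // z _.
exists (Num.bound (enorm (z - 0))) => //=.
by apply: archi_boundP; exact: enorm_ge0.
Qed.

Lemma mass_gt0 : (0 < mass setT)%E.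
Proof.
rewrite lt_neqAle mass_ge0 andbT eq_sym; apply/eqP => m0.
apply: f_neq0.
have := (ae_eq_integral_abs mu measurableT (measurable_int _ intf)).1 m0.
by apply: filterS => z /(_ I)/= [].
Qed.

Lemma mass_eball_gt0 : exists k : nat, (0 < mass (eball (0 : V) k%:R))%E.
Proof.
have [k _ /(_ k (leqnn k)) /= tk] := cvge_lt _ _ _ _ cvg_mass_tail mass_gt0.
exists k; rewrite lt_neqAle mass_ge0 andbT eq_sym; apply/eqP => m0.
have mE := measurable_eball R d (0 : V) k%:R.
move: tk; rewrite -[X in (_ < integral _ X _)%E](setUv (eball (0 : V) k%:R)).
have := @ge0_integral_setU _ lebesgueT R mu _ _ mE (measurableC mE)
  (fun z => `|(f z)%:E|)%E.
rewrite setUv => ->.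
- by rewrite m0 add0e ltxx.
- exact: measurable_absf.
- by move=> z _; exact: abse_ge0.
- by apply/disj_setPCl.
Qed.

Lemma avg_lower_bound : exists c : R, 0 < c /\
  \forall N \near \oo, forall x, enorm x <= N%:R ->
    ((c / N%:R ^+ d.+1)%:E < avg f x (2 * N%:R))%E.
Proof.
have [k mk] := mass_eball_gt0.
have mE := measurable_eball R d (0 : V) k%:R.
have mf : mass (eball (0 : V) k%:R) \is a fin_num by exact: mass_fin.
pose b := fine (mass (eball (0 : V) k%:R)).
have b0 : 0 < b by rewrite fine_gt0// mk/= -ge0_fin_numE ?mass_ge0.
(* The ball of radius [2 * N%:R] lies in a cube of side [4 * N%:R], whence [4 ^+ d.+1]; halving [b]
   makes the inequality strict. *)
exists (b / 2 / 4 ^+ d.+1); split; first by rewrite !divr_gt0// exprn_gt0.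
near=> N => x xN.
have kN : (k <= N)%N by near: N; exact: nbhs_infty_ge.
have N0 : (0 < N)%N by near: N; exact: nbhs_infty_gt.
have N0' : 0 < N%:R :> R by rewrite ltr0n.
have r0 : 0 < 2 * N%:R :> R by rewrite mulr_gt0.
rewrite lt_avg//.
apply: (@lt_le_trans _ _ (mass (eball (0 : V) k%:R))); last first.
  apply: le_mass => //; first exact: measurable_eball.
  apply: eball_subset; rewrite sub0r enormN -(ler_nat R) in kN *.
  lra.
rewrite -(fineK mf) -/b.
apply: (@le_lt_trans _ _ (b / 2)%:E); last by rewrite lte_fin ltr_pdivrMr// ltr_pMr// ltr1n.
have c0 : 0 < b / 2 / 4 ^+ d.+1 / N%:R ^+ d.+1 by rewrite !divr_gt0// exprn_gt0.
have := lebesgue_eball_le R d x _ r0.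
move=> /(lee_wpmul2l (ltW c0 : (0 <= (_)%:E)%E)) /le_trans; apply.
rewrite -EFinM lee_fin.
have -> : 2 * N%:R *+ 2 = 4 * N%:R :> R by ring.
rewrite exprMn -[leLHS]mulrA -[(_ / 4 ^+ _) * _]mulrA.
rewrite [X in _ * X](_ : _ = 1) ?mulr1//.
by rewrite [N%:R ^- _ * _]mulrCA mulVf ?mulr1 ?mulVf// expf_neq0// gt_eqF.
Unshelve. all: by end_near.
Qed.

Theorem low_freq_density (kappa C : R) (m : V -> \bar R) (E : V -> set R)
    (freq : V -> R) :
  0 <= kappa <= 1 -> 1 + kappa < C ->
  (forall x, m x = ereal_sup [set s | exists r y,
    [/\ 0 < r, enorm (x - y) <= kappa * r & s = avg f y r]]) ->
  (forall x, E x = [set r | 0 < r /\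
    exists2 y, enorm (x - y) <= kappa * r & m x = avg f y r]) ->
  (forall x, freq x = if E x == set0 then 0 else inf (E x)) ->
  (mu (low_freq_set (@enorm R d.+1) freq C N) / (N%:R ^+ d.+1)%:E)%E @[N --> \oo]
    --> 0%E.
Proof.
move=> /andP[kappa0 kappa1] kC mE EE freqE.
have [c [c0 hc]] := avg_lower_bound.
(* The gap between [C'] and [C] turns the weak bound on the frequency into the strict one that
   [exists_small_ball] asks for. *)
pose C' := (C + (1 + kappa)) / 2.
have C'C : C' < C by rewrite /C'; lra.
have C'k : 1 + kappa < C' by rewrite /C'; lra.
have C'0 : 0 < C' by lra.
pose delta := 1 - (1 + kappa) / C'.
have delta0 : 0 < delta by rewrite subr_gt0 ltr_pdivrMr// mul1r.
apply: cvge0_nearP => [N|eta eta0].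
  by rewrite mule_ge0 ?measure_ge0// inve_ge0 lee_fin exprn_ge0.
(* With [2 * eps <= 1], the power [(2 * eps) ^+ d.+1] is at most [2 * eps], so the central ball
   takes at most half of [eta]; the tail mass below [eta / 2 / K] accounts for the other half. *)
pose eps := Num.min 1 eta / 4.
have eps0 : 0 < eps by rewrite divr_gt0// lt_min ltr01.
have eps_eta : (2 * eps) ^+ d.+1 <= eta / 2.
  have e1 : 2 * eps <= 1.
    have : Num.min 1 eta <= 1 by rewrite ge_min lexx.
    rewrite /eps; lra.
  apply: (@le_trans _ _ (2 * eps)).
    by rewrite -[leRHS]expr1 ler_wiXn2l// mulr_ge0// ltW.
  have : Num.min 1 eta <= eta by rewrite ge_min lexx orbT.
  rewrite /eps; lra.
pose K := weak_const R d / c.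
have K0 : 0 < K by apply: divr_gt0 => //; apply: exprn_gt0; apply: mulr_gt0.
have eK0 : (0 < (eta / 2 / K)%:E)%E by rewrite lte_fin; apply: divr_gt0 => //; exact: divr_gt0.
have [k0 _ hk0] := cvge_lt _ _ _ _ cvg_mass_tail eK0.
have de0 : 0 < delta * eps by rewrite mulr_gt0.
near=> N.
have N0 : (0 < N)%N by near: N; exact: nbhs_infty_gt.
have N0' : 0 < N%:R :> R by rewrite ltr0n.
have ND0 : 0 < N%:R ^+ d.+1 :> R by rewrite exprn_gt0.
have hcN : forall x, enorm x <= N%:R ->
    ((c / N%:R ^+ d.+1)%:E < avg f x (2 * N%:R))%E by near: N.
have Nk0 : k0%:R <= delta * eps * N%:R.
  rewrite -ler_pdivrMl//; near: N; exact: nbhs_infty_ger.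
pose A : set lebesgueT := ~` eball (0 : V) k0%:R.
have mA : measurable A by apply: measurableC; exact: measurable_eball.
have mAe : fine (mass A) < eta / 2 / K.
  rewrite -lte_fin fineK; last exact: mass_fin.
  exact: (hk0 k0 (leqnn k0)).
set S := low_freq_set _ _ _ _.
pose S1 := S `&` [set x | eps * N%:R <= enorm x].
have S_sub : S `<=` eball (0 : V) (eps * N%:R) `|` S1.
  move=> x Sx; have [xe|xe] := leP (eps * N%:R) (enorm x); first by right.
  by left; rewrite /eball/= subr0.
pose t := c / N%:R ^+ d.+1.
have t0 : 0 < t by rewrite divr_gt0.
have S1_le : (mu S1 <= (weak_const R d / t * fine (mass A))%:E)%E.
  apply: weak_type_bound => // x [[x0 xN xC] /= xe].
  have nx0 : 0 < enorm x by rewrite lt_neqAle enorm_ge0 eq_sym enorm_eq0 x0.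
  have tm : (t%:E < m x)%E.
    apply: lt_le_trans (hcN x xN) _; rewrite mE; apply: ereal_sup_ubound.
    exists (2 * N%:R), x; split=> //; first by rewrite mulr_gt0.
    by rewrite subrr enorm0 !mulr_ge0.
  have a0 : 0 < enorm x / C' by rewrite divr_gt0.
  have fx : freq x < enorm x / C'.
    move: xC; rewrite ler_pdivrMr// => /le_lt_trans; apply.
    by rewrite div1r mulrC ltr_pM2l// ltf_pV2 ?posrE//; lra.
  rewrite freqE in fx.
  have [y [r [r0 ra xy ty]]] :=
    exists_small_ball _ _ _ intf _ _ _ _ _ _ kappa0 (mE x) (EE x) t0 tm a0 fx.
  exists y, r; split=> //.
    by apply: (le_trans xy); rewrite ler_piMl// ltW.
  move=> z zy; rewrite /A /eball/= subr0 => zk.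
  (* A point of the ball within [k0] of the origin would force this. But [k0%:R <= delta * enorm x],
     and the choice of [delta] with [r < enorm x / C'] gives the reverse inequality. *)
  have : enorm x < kappa * r + r + k0%:R.
    have := enorm_trans _ _ y x 0; have := enorm_trans _ _ z y 0.
    rewrite !subr0 (enormB _ _ y z); move: zy xy zk; rewrite /eball/= => *; lra.
  rewrite ltNge => /negP; apply.
  have dE : delta * enorm x = enorm x - (1 + kappa) * (enorm x / C').
    by rewrite /delta mulrBl mul1r mulrAC mulrA.
  have : delta * eps * N%:R <= delta * enorm x by rewrite -mulrA ler_pM2l.
  have : (1 + kappa) * r <= (1 + kappa) * (enorm x / C').
    by rewrite ler_pM2l ?ltr_pwDl// ltW.
  rewrite mulrDl mul1r dE => *; lra.
have eN0 : 0 < eps * N%:R by rewrite mulr_gt0.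
rewrite inver gt_eqF// lee_pdivrMr//.
apply: (le_trans (le_lebesgue _ _ _ _ S_sub)).
apply: (le_trans (outer_measureU2 (@lebesgue_outer R d.+1) _ _)).
apply: (le_trans (leeD (lebesgue_eball_le R d _ _ eN0) S1_le)).
rewrite -!EFinD -EFinM lee_fin.
have -> : eps * N%:R *+ 2 = 2 * eps * N%:R by ring.
have -> : weak_const R d / t = K * N%:R ^+ d.+1.
  by rewrite /t /K invf_div mulrA mulrAC.
rewrite exprMn.
have h1 : (2 * eps) ^+ d.+1 * N%:R ^+ d.+1 <= eta / 2 * N%:R ^+ d.+1.
  by rewrite ler_pM2r.
have h2 : K * N%:R ^+ d.+1 * fine (mass A) <= eta / 2 * N%:R ^+ d.+1.
  by rewrite mulrAC ler_pM2r// mulrC -ler_pdivlMr// ltW.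
lra.
Unshelve. all: by end_near.
Qed.

End low_frequency.

(** * Discrete tools: tails of summable functions and one-sided coverings *)

Section summable_int.
Context (R : realType) (f : int -> R).
Hypothesis sf : summable [set: int] (EFin \o f).

Lemma summable_seq_le (M : \bar R) : M = (\esum_(i in [set: int]) `|(f i)%:E|)%E ->
  forall s : seq int, uniq s -> ((\sum_(j <- s) `|f j|)%:E <= M)%E.
Proof.
move=> -> s us; rewrite -sumEFin; apply: ereal_sup_ubound.
exists [set` s]; first by split=> //; exact: finite_seq.
by rewrite -fsbig_seq.
Qed.

Lemma summable_bound : exists2 M, 0 < M & forall s : seq int, uniq s ->
  \sum_(j <- s) `|f j| <= M.
Proof.
set E := (\esum_(i in [set: int]) `|(f i)%:E|)%E.
have E0 : (0 <= E)%E by apply: esum_ge0 => i _; exact: abse_ge0.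
have Ef : E \is a fin_num by rewrite ge0_fin_numE.
exists (fine E + 1); first by rewrite ltr_wpDl// fine_ge0.
move=> s us; rewrite -lee_fin EFinD fineK//.
by apply: (le_trans (summable_seq_le _ erefl s us)); rewrite leeDl.
Qed.

Lemma summable_tail (e : R) : 0 < e -> exists K : nat, forall s : seq int, uniq s ->
  \sum_(j <- s | (K <= `|j|)%N) `|f j| <= e.
Proof.
move=> e0.
set E := (\esum_(i in [set: int]) `|(f i)%:E|)%E.
have E0 : (0 <= E)%E by apply: esum_ge0 => i _; exact: abse_ge0.
have Ef : E \is a fin_num by rewrite ge0_fin_numE.
have : (E - e%:E < E)%E by rewrite lteBlDr// lteDl.
move=> /ereal_sup_gt[_ [X [finX _] <-]].
have [Y ->] := finite_fsetP.1 finX.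
rewrite -fsbig_seq//= sumEFin => EX.
(* Indices of absolute value at least this bound avoid [Y], which already carries all but [e] of the
   total, so they share less than [e]. *)
exists (\max_(j <- Y) `|j|.+1)%N => s us.
rewrite -big_filter; set s' := seq.filter _ s.
have us' : uniq (s' ++ Y).
  rewrite cat_uniq filter_uniq// fset_uniq andbT /=; apply/hasPn => j jY.
  rewrite mem_filter negb_and -ltnNge; apply/orP; left.
  by rewrite (@leq_bigmax_seq _ _ _ (fun j : int => `|j|.+1)%N).
have := summable_seq_le _ erefl _ us'; rewrite -/E big_cat/=.
move: EX; rewrite -(fineK Ef) -EFinB lte_fin lee_fin => *; lra.
Qed.

End summable_int.

(* Greedy selection from the left: an interval starting at the leftmost uncovered
   point of [S] is kept, so the kept intervals are disjoint and cover [S]. *)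
Lemma one_sided_covering (R : realType) (h : nat -> R) (t : R) (S : pred nat) (L : nat) :
  0 <= t -> (forall i, 0 <= h i) ->
  (forall n, S n -> exists s : nat, t * s.+1%:R <= \sum_(n <= i < n + s.+1) h i) ->
  exists L', t * (count S (iota 0 L))%:R <= \sum_(0 <= i < L') h i.
Proof.
move=> t0 h0 hS.
suff H k p : exists2 L', (p <= L')%N &
    t * (count S (iota p k))%:R <= \sum_(p <= i < L') h i.
  by have [L' _ h1] := H L 0%N; exists L'.
have [n] := ubnP k; elim: n k p => // n IH [|k] p.
  by move=> _; exists p => //=; rewrite mulr0 sumr_ge0.
rewrite ltnS => kn.
have [Sp|nSp] := boolP (S p); last first.
  have [L' pL' h1] := IH k p.+1 kn.
  exists L'; first exact: ltnW.
  rewrite /= (negbTE nSp) add0n; apply: (le_trans h1).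
  by rewrite [leRHS]big_ltn// lerDr.
have [s hs] := hS p Sp.
(* If the chosen interval reaches past the [k.+1] points under consideration, it alone pays for all
   of them; this is why the endpoint [L'] may exceed the window. *)
have [ks|sk] := leqP k s.
  exists (p + s.+1)%N; first by rewrite leq_addr.
  apply: le_trans hs; apply: ler_wpM2l => //; rewrite ler_nat.
  by apply: (leq_trans (count_size _ _)); rewrite size_iota.
have [L' pL' h1] := IH (k - s)%N (p + s.+1)%N (leq_ltn_trans (leq_subr _ _) kn).
exists L'; first by apply: leq_trans pL'; rewrite leq_addr.
have -> : k.+1 = (s.+1 + (k - s))%N by lia.
rewrite iotaD count_cat natrD mulrDr.
rewrite (@big_cat_nat _ _ _ (p + s.+1)) ?leq_addr//; apply: lerD => //.
apply: le_trans hs; apply: ler_wpM2l => //; rewrite ler_nat.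
by apply: (leq_trans (count_size _ _)); rewrite size_iota.
Qed.

Lemma counting_seq_le (T : choiceType) (R : realType) (A : set T) (s : seq T) :
  A `<=` [set` s] -> (counting A <= (size s)%:R%:E :> \bar R)%E.
Proof.
move=> As.
have fA : finite_set A by apply: sub_finite_set As _; exact: finite_seq.
rewrite /counting; case: ifPn => [_|/negP]; last by rewrite inE.
rewrite lee_fin ler_nat.
have : {subset fset_set A <= s} by move=> x; rewrite in_fset_set// inE => /As.
exact: uniq_leq_size.
Qed.

(** If both halves, each containing [n], fell short at height [t / 2], the whole sum would be less
    than [t / 2 * (rho + s + 2)], which is at most [t * (rho + s + 1)]. *)
Lemma two_sided_sum_split (R : realType) (w : int -> R) (n : int) (rho s : nat) (t : R) :
  0 <= t -> (forall j, 0 <= w j) ->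
  t * (rho + s + 1)%N%:R <=
    \sum_(0 <= i < (rho + s + 1)%N) w (n + (i%:Z - rho%:Z)) ->
  t / 2 * s.+1%:R <= \sum_(0 <= i < s.+1) w (n + i%:Z) \/
  t / 2 * rho.+1%:R <= \sum_(0 <= i < rho.+1) w (n - i%:Z).
Proof.
move=> t0 w0 h.
have [hs|hs] := leP (t / 2 * s.+1%:R) (\sum_(0 <= i < s.+1) w (n + i%:Z)); first by left.
have [hr|hr] := leP (t / 2 * rho.+1%:R) (\sum_(0 <= i < rho.+1) w (n - i%:Z)); first by right.
exfalso; move: h; rewrite leNgt => /negP; apply.
rewrite (@big_cat_nat _ _ _ rho)//=; last by lia.
have -> : \sum_(rho <= i < rho + s + 1) w (n + (i%:Z - rho%:Z)) =
    \sum_(0 <= i < s.+1) w (n + i%:Z).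
  rewrite -{1}[rho]add0n big_addn (_ : (rho + s + 1 - rho)%N = s.+1); last by lia.
  by apply: eq_bigr => i _; congr w; lia.
have : \sum_(0 <= i < rho) w (n + (i%:Z - rho%:Z)) <= \sum_(0 <= i < rho.+1) w (n - i%:Z).
  rewrite [leRHS]big_nat_rev/= big_nat_recr//=.
  rewrite (@eq_big_nat _ _ _ _ _ _ (fun i => w (n - (0 + rho.+1 - i.+1)%N%:Z))); last first.
    by move=> i /andP[_ ir]; congr w; lia.
  by rewrite lerDl.
have -> : (rho + s + 1)%:R = rho.+1%:R + s.+1%:R - 1 :> R.
  by rewrite addn1 -addSn natrD -[s.+1%:R]natr1 addrA addrK.
have : 1 <= rho.+1%:R :> R by rewrite ler1n.
have : 1 <= s.+1%:R :> R by rewrite ler1n.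
move: (rho.+1%:R) (s.+1%:R) hs hr => a b; nra.
Qed.

Lemma absz_shift_ge (K rho s i : nat) (x : int) : (i < rho + s + 1)%N ->
  (K + (rho + s) <= `|x|)%N -> (K <= `|(x + (i%:Z - rho%:Z))%R|)%N.
Proof. lia. Qed.

(** Enumerating the integers of [[-N, N]] by naturals, here from the left and next from the right,
    brings rightward and leftward intervals alike into the form of [one_sided_covering]. *)
Lemma mem_shifted_iota (N : nat) (P : pred int) (x : int) : (`|x| <= N)%N -> P x ->
  x \in [seq i%:Z - N%:Z | i : nat <- iota 0 (2 * N).+1 & P (i%:Z - N%:Z)].
Proof.
move=> xN Px; apply/mapP; exists (absz (x + N%:Z)); last by lia.
rewrite mem_filter mem_iota (_ : _ - _ = x) ?Px; lia.
Qed.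

Lemma mem_reflected_iota (N : nat) (P : pred int) (x : int) : (`|x| <= N)%N -> P x ->
  x \in [seq N%:Z - i%:Z | i : nat <- iota 0 (2 * N).+1 & P (N%:Z - i%:Z)].
Proof.
move=> xN Px; apply/mapP; exists (absz (N%:Z - x)); last by lia.
rewrite mem_filter mem_iota (_ : _ - _ = x) ?Px; lia.
Qed.

(** * Density of the low-frequency set on the integers *)

Section discrete_low_frequency.
Context (R : realType) (f : int -> R).
Hypothesis sf : summable [set: int] (EFin \o f).
Variable n0 : int.
Hypothesis fn0 : f n0 <> 0.

Lemma zavg_le_max n rho s : ((zavg f n rho s)%:E <= zuncentered_max f n)%E.
Proof. by apply: ereal_sup_ubound; exists (rho, s). Qed.

Lemma intr_absz (x : int) : `|x%:~R| = `|x|%N%:R :> R.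
Proof. by rewrite -intr_norm -abszE. Qed.

(** The window of radius [2 * N] about [n] contains [n0] and has [4 * N + 1 <= 5 * N] points. *)
Lemma zavg_lower_bound (N : nat) n : (0 < N)%N -> (`|n0| <= N)%N -> (`|n| <= N)%N ->
  `|f n0| / 5 / N%:R <= zavg f n (2 * N) (2 * N).
Proof.
move=> N0 n0N nN; rewrite /zavg [leRHS]mulrC.
have N0' : 0 < N%:R :> R by rewrite ltr0n.
apply: (@le_trans _ _ (`|f n0| / (2 * N + 2 * N + 1)%:R)).
  rewrite -mulrA ler_wpM2l// -invfM lef_pV2 ?posrE ?mulr_gt0//.
  by rewrite -natrM ler_nat; lia.
rewrite ler_wpM2r ?invr_ge0//.
rewrite (bigD1_seq (absz (n0 - n + (2 * N)%:Z)))/= ?iota_uniq//; last first.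
  by rewrite mem_index_iota; lia.
rewrite (_ : n + _ = n0); last by lia.
by rewrite lerDl sumr_ge0.
Qed.

Lemma zuncentered_max_attained n :
  exists rho s, zuncentered_max f n = (zavg f n rho s)%:E.
Proof.
have [M M0 hM] := summable_bound _ _ sf.
pose N := (`|n0| + `|n|).+1%N.
pose l := `|f n0| / 5 / N%:R.
have l0 : 0 < l by rewrite !divr_gt0// ?normr_gt0//; exact/eqP.
have hl : l <= zavg f n (2 * N) (2 * N) by apply: zavg_lower_bound; lia.
(* Windows with more than [B] points average at most [M / B <= l], no more than the reference window
   does. Taking [B >= 2 * N] keeps that window in the finite range that is searched. *)
pose B := maxn (2 * N) (Num.bound (M / l)).
have zM rho s : (B < rho + s + 1)%N -> zavg f n rho s <= l.
  move=> Brs; rewrite /zavg mulrC ler_pdivrMr; last by rewrite ltr0n addn1.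
  apply: (@le_trans _ _ M).
    have := hM (map (fun i : nat => n + (i%:Z - rho%:Z)) (iota 0 (rho + s + 1))).
    rewrite big_map /index_iota subn0; apply.
    by rewrite map_inj_uniq ?iota_uniq// => i j; lia.
  rewrite mulrC -ler_pdivrMr//; apply: ltW.
  apply: (lt_le_trans (archi_boundP _)); first by rewrite divr_ge0 ?ltW.
  by rewrite ler_nat; apply: leq_trans (ltnW Brs); exact: leq_maxr.
pose F (p : 'I_B.+1 * 'I_B.+1) := zavg f n p.1 p.2.
have [p _ pmax] := @arg_maxP _ _ _ (ord0, ord0) xpredT F isT.
have hF rho s : (rho <= B)%N -> (s <= B)%N -> zavg f n rho s <= F p.
  move=> rB sB.
  by have := pmax (Ordinal (rB : (rho < B.+1)%N), Ordinal (sB : (s < B.+1)%N)) isT.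
exists p.1, p.2; apply/eqP; rewrite eq_le zavg_le_max andbT.
apply: ge_ereal_sup => _ [[rho s] _ <-] /=; rewrite lee_fin.
have [h|h] := leqP (rho + s + 1) B; first by apply: hF; lia.
apply: (le_trans (zM rho s h)); apply: (le_trans hl).
by apply: hF; exact: leq_maxl.
Qed.

(** Attainment rules out the default value of [minset_nat], so the minimum is realized by an actual
    window. *)
Lemma zuncentered_freq_attained n : exists rho s,
  zuncentered_max f n = (zavg f n rho s)%:E /\
  2 * zuncentered_freq f n = (rho + s)%:R.
Proof.
have [rho [s h]] := zuncentered_max_attained n.
rewrite /zuncentered_freq /minset_nat.
case: pselect => [exA|]; last first.
  by move=> nA; exfalso; apply: nA; exists (rho + s)%N; apply/asboolP; exists rho, s.
case: ex_minnP => k /asboolP[rho' [s' [-> h']]] _.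
by exists rho', s'; split=> //; rewrite mulrA divff ?mul1r.
Qed.

Theorem zlow_freq_density (C : R) : 2 < C ->
  (counting (low_freq_set (fun n : int => `|n%:~R|%R) (zuncentered_freq f) C N)
    / (N%:R)%:E)%E @[N --> \oo] --> (0%E : \bar R).
Proof.
move=> C2.
have C0 : 0 < C by lra.
pose c := `|f n0| / 5.
have c0 : 0 < c by rewrite divr_gt0// normr_gt0; exact/eqP.
(* A window realizing the frequency at [x] has [rho + s <= 2 / C * |x|], so it keeps distance at
   least [delta * |x|] from the origin. *)
pose delta := 1 - 2 / C.
have delta0 : 0 < delta by rewrite subr_gt0 ltr_pdivrMr// mul1r.
apply: cvge0_nearP => [N|eta eta0].
  by rewrite mule_ge0 ?inve_ge0 ?lee_fin// /counting; case: ifPn.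
pose eps := eta / 8; have eps0 : 0 < eps by rewrite divr_gt0.
(* With [t = c / N%:R], the covering bound [t / 2 * count <= c * eta / 16] gives
   [count <= eta / 8 * N%:R] on each side. The central block has at most [eta / 4 * N%:R + 1]
   points, so the total stays below [eta * N%:R]. *)
have e'0 : 0 < c * eta / 16 by rewrite divr_gt0// mulr_gt0.
have [K hK] := summable_tail _ _ sf _ e'0.
pose w (j : int) := if (K <= `|j|)%N then `|f j| else 0.
have w0 j : 0 <= w j by rewrite /w; case: ifP.
have hw (phi : nat -> int) L : injective phi ->
    \sum_(0 <= i < L) w (phi i) <= c * eta / 16.
  move=> iphi; have := hK (map phi (iota 0 L)).
  rewrite map_inj_uniq// iota_uniq => /(_ isT).
  by rewrite big_mkcond/= big_map /index_iota subn0.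
have de0 : 0 < delta * eps by rewrite mulr_gt0.
near=> N.
have N0 : (0 < N)%N by near: N; exact: nbhs_infty_gt.
have N0' : 0 < N%:R :> R by rewrite ltr0n.
have n0N : (`|n0| <= N)%N by near: N; exact: nbhs_infty_ge.
have KN : K%:R <= delta * (eps * N%:R).
  by rewrite mulrA -ler_pdivrMl//; near: N; exact: nbhs_infty_ger.
have N4 : 1 <= eta / 4 * N%:R.
  by rewrite -ler_pdivrMl ?divr_gt0//; near: N; exact: nbhs_infty_ger.
pose t := c / N%:R; have t0 : 0 < t by rewrite divr_gt0.
set S := low_freq_set _ _ _ _.
pose PR (x : int) := `[< exists s : nat,
  t / 2 * s.+1%:R <= \sum_(0 <= i < s.+1) w (x + i%:Z) >].
pose PL (x : int) := `[< exists s : nat,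
  t / 2 * s.+1%:R <= \sum_(0 <= i < s.+1) w (x - i%:Z) >].
have t20 : 0 <= t / 2 by rewrite divr_ge0// ltW.
pose toR (i : nat) : int := i%:Z - N%:Z.
pose toL (i : nat) : int := N%:Z - i%:Z.
have itoR : injective toR by move=> i j /addIr[].
have itoL : injective toL by move=> i j /addrI/oppr_inj[].
have [LR cR] : exists L', t / 2 * (count (PR \o toR) (iota 0 (2 * N).+1))%:R <=
    \sum_(0 <= i < L') w (toR i).
  apply: one_sided_covering => // n /asboolP[s hs]; exists s.
  rewrite -{1}[n]add0n big_addn addKn; apply: (le_trans hs).
  by apply: ler_sum => i _; rewrite (_ : toR n + i%:Z = toR (i + n)%N)// /toR PoszD; ring.
have [LL cL] : exists L', t / 2 * (count (PL \o toL) (iota 0 (2 * N).+1))%:R <=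
    \sum_(0 <= i < L') w (toL i).
  apply: one_sided_covering => // n /asboolP[s hs]; exists s.
  rewrite -{1}[n]add0n big_addn addKn; apply: (le_trans hs).
  by apply: ler_sum => i _; rewrite (_ : toL n - i%:Z = toL (i + n)%N)// /toL PoszD; ring.
have {}cR := le_trans cR (hw _ _ itoR).
have {}cL := le_trans cL (hw _ _ itoL).
pose M := Num.truncn (eps * N%:R).
have [M1 M2] : M%:R <= eps * N%:R /\ eps * N%:R < M.+1%:R.
  by have /andP[] := truncn_itv (mulr_ge0 (ltW eps0) (ltW N0')).
pose s0 := [seq i%:Z - M%:Z | i : nat <- iota 0 (2 * M).+1 & predT (i%:Z - M%:Z)].
pose sR := [seq toR i | i <- iota 0 (2 * N).+1 & (PR \o toR) i].
pose sL := [seq toL i | i <- iota 0 (2 * N).+1 & (PL \o toL) i].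
(* Three lists cover [S]: the integers near the origin, and those starting a rightward or a leftward
   interval of large tail average. *)
have Ssub : S `<=` [set` s0 ++ sR ++ sL].
  move=> x [x0]; rewrite intr_absz ler_nat => xN xC.
  change (is_true (x \in s0 ++ sR ++ sL)).
  rewrite !mem_cat; have [xe|xe] := leP (eps * N%:R) `|x|%N%:R; last first.
    apply/orP; left; apply: mem_shifted_iota => //.
    by have := lt_trans xe M2; rewrite ltr_nat.
  apply/orP; right.
  have x0' : 0 < `|x|%N%:R :> R by rewrite ltr0n absz_gt0.
  have [rho [s [mx fx]]] := zuncentered_freq_attained x.
  have tz : t <= zavg f x rho s.
    rewrite -lee_fin -mx; apply: le_trans (zavg_le_max x (2 * N) (2 * N)).
    by rewrite lee_fin; exact: zavg_lower_bound.
  have rs : (rho + s)%:R <= 2 / C * `|x|%N%:R.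
    by rewrite -fx -mulrA ler_pM2l//; move: xC; rewrite ler_pdivrMr// div1r.
  have Kx : (K + (rho + s) <= `|x|)%N.
    rewrite -(ler_nat R) natrD.
    have : delta * (eps * N%:R) <= delta * `|x|%N%:R by rewrite ler_pM2l.
    have -> : delta * `|x|%N%:R = `|x|%N%:R - 2 / C * `|x|%N%:R by rewrite mulrBl mul1r.
    move=> h; lra.
  have hS : t * (rho + s + 1)%N%:R <=
      \sum_(0 <= i < (rho + s + 1)%N) w (x + (i%:Z - rho%:Z)).
    rewrite (@eq_big_nat _ _ _ _ _ _ (fun i => `|f (x + (i%:Z - rho%:Z))|)); last first.
      move=> i /andP[_ ir]; by rewrite /w (absz_shift_ge _ _ _ _ _ ir Kx).
    by rewrite -ler_pdivlMr ?ltr0n ?addn1// -addn1 mulrC.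
  have [h|h] := two_sided_sum_split _ _ _ _ _ _ (ltW t0) w0 hS.
    by apply/orP; left; apply: mem_shifted_iota => //; apply/asboolP; exists s.
  by apply/orP; right; apply: mem_reflected_iota => //; apply/asboolP; exists rho.
rewrite inver gt_eqF// lee_pdivrMr//.
apply: (le_trans (counting_seq_le _ _ _ _ Ssub)).
have szR : size sR = count (PR \o toR) (iota 0 (2 * N).+1).
  by rewrite size_map size_filter.
have szL : size sL = count (PL \o toL) (iota 0 (2 * N).+1).
  by rewrite size_map size_filter.
have szM : size s0 = (2 * M).+1 by rewrite size_map size_filter count_predT size_iota.
rewrite -szR in cR; rewrite -szL in cL.
rewrite -EFinM lee_fin !size_cat szM !natrD.
have bound (u : R) : t / 2 * u <= c * eta / 16 -> u <= eta / 8 * N%:R.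
  rewrite /t => h.
  rewrite -(ler_pM2l (divr_gt0 c0 N0')).
  have -> : c / N%:R * (eta / 8 * N%:R) = 2 * (c * eta / 16) by field; rewrite gt_eqF.
  lra.
have {}cR := bound _ cR; have {}cL := bound _ cL.
have -> : (2 * M).+1%:R = 2 * M%:R + 1 :> R by rewrite -natr1 natrM.
have eN0 := mulr_gt0 eta0 N0'.
rewrite /eps in M1; lra.
Unshelve. all: by end_near.
Qed.

End discrete_low_frequency.

(** * Closed balls and the two continuous cases *)

Lemma closure_eball (R : realType) (d : nat) (x y : 'rV[R]_d) (r : R) : 0 < r ->
  closure (eball y r) x <-> enorm (x - y) <= r.
Proof.
move=> r0; split=> [cx|xy B /nbhs_ballP[e /= e0 eB]].
  rewrite leNgt; apply/negP => rx.
  pose e := (enorm (x - y) - r) / (d%:R + 1).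
  have d0 : 0 < d%:R + 1 :> R by rewrite ltr_wpDl.
  have e0 : 0 < e by rewrite divr_gt0// subr_gt0.
  have [z [/= zy /ball_sub_eball/= xz]] := cx _ (nbhsx_ballx x e e0).
  have := enorm_trans _ _ z x y.
  have eE : e * (d%:R + 1) = enorm (x - y) - r by rewrite divfK// gt_eqF.
  move: zy xz; rewrite /eball/= => *; nra.
(* Moving [x] towards [y] by the fraction [s] leaves it at distance at most [(1 - s) * r < r] from
   [y] and displaces it by at most [s * r < e]. *)
pose s := e / (e + r).
have er0 : 0 < e + r by rewrite addr_gt0.
have s0 : 0 < s by rewrite divr_gt0.
have s1 : s < 1 by rewrite ltr_pdivrMr// mul1r ltrDl.
have sr : s * r < e by rewrite mulrAC ltr_pdivrMr// ltr_pM2l// ltrDr.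
exists (x + s *: (y - x)); split.
  rewrite /eball/= (_ : _ - y = (1 - s) *: (x - y)).
    rewrite enormZ gtr0_norm ?subr_gt0//; nra.
  by rewrite scalerBl scale1r -[y - x]opprB scalerN addrAC.
apply: eB; apply/ball_rVP; split=> // i.
rewrite !mxE opprD addrA subrr sub0r normrN normrM gtr0_norm//.
apply: le_lt_trans sr; rewrite ler_pM2l//.
have := coord_le_enorm _ _ (y - x) i; rewrite !mxE => /le_trans; apply.
by rewrite enormB.
Qed.

Theorem proposition2p3 (R : realType) (d : nat) (hd : (1 <= d)%N) :
  (forall f : 'rV[R]_d -> R,
     (@lebesgue R d).-integrable setT (EFin \o f) ->
     ~ {ae @lebesgue R d, forall x, f x = 0} ->
     forall C : R, 1 < C ->
     (@lebesgue R d (low_freq_set (@enorm R d) (centered_freq f) C N)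
        / (N%:R ^+ d)%:E)%E @[N --> \oo] --> 0%E)
  /\
  (forall f : 'rV[R]_d -> R,
     (@lebesgue R d).-integrable setT (EFin \o f) ->
     ~ {ae @lebesgue R d, forall x, f x = 0} ->
     forall C : R, 2 < C ->
     (@lebesgue R d (low_freq_set (@enorm R d) (uncentered_freq f) C N)
        / (N%:R ^+ d)%:E)%E @[N --> \oo] --> 0%E)
  /\
  (forall f : int -> R,
     summable [set: int] (EFin \o f) ->
     (exists n, f n <> 0) ->
     forall C : R, 2 < C ->
     (counting (low_freq_set (fun n : int => `|n%:~R|%R) (zuncentered_freq f) C N)
        / (N%:R)%:E)%E @[N --> \oo] --> (0%E : \bar R)).
Proof.
case: d hd => // d _; split; [|split].
- move=> f intf f0 C C1.
  (* For [kappa = 0] the only admissible center is [x] itself, which recovers the centered maximal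
     function. *)
  have adm0 x y r : enorm (x - y) <= 0 * r <-> x = y.
    rewrite mul0r; split=> [h|->]; last by rewrite subrr enorm0.
    by apply/eqP; rewrite -subr_eq0 -enorm_eq0 eq_le h enorm_ge0.
  apply: (@low_freq_density _ _ _ intf f0 0 C (centered_max f) (centered_radii f)) => //.
  + by rewrite lexx ler01.
  + by rewrite addr0.
  + move=> x; congr ereal_sup; apply/seteqP; split=> s /=.
      by move=> [r r0 <-]; exists r, x; split=> //; apply/adm0.
    by move=> [r [y [r0 /adm0 <- ->]]]; exists r.
  + move=> x; apply/seteqP; split=> r /= [r0].
      by move=> h; split=> //; exists x => //; apply/adm0.
    by move=> [y /adm0 <-].
- move=> f intf f0 C C2.
  apply: (@low_freq_density _ _ _ intf f0 1 C (uncentered_max f) (uncentered_radii f)) => //.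
  + by rewrite lexx ler01.
  + move=> x; congr ereal_sup; apply/seteqP; split=> s /= [r [y [r0 xy ->]]];
      by exists r, y; split=> //; move: xy; rewrite mul1r closure_eball.
  + move=> x; apply/seteqP; split=> r /= [r0 [y xy m]];
      by split=> //; exists y => //; move: xy; rewrite mul1r closure_eball.
- by move=> f sf [n0 fn0] C C2; exact: zlow_freq_density sf n0 fn0 C C2.
Qed.
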